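(* Let $A$ be an $H$-supralgebra on $\mathbb{R}^N$ which is translation invariant and each of whose elements is uniformly continuous. Then the translations $x\mapsto x+y$ of $\mathbb{R}^N$ extend to a group of homeomorphisms $T(y):\Delta(A)\to\Delta(A)$, $y\in\mathbb{R}^N$, characterized by $\mathcal{G}(u(\cdot+y))(s)=\mathcal{G}(u)(T(y)s)$ for all $u\in A$, $s\in\Delta(A)$, and $\{T(y):y\in\mathbb{R}^N\}$ is a continuous $N$-dimensional dynamical system on $\Delta(A)$ whose invariant probability measure is the $M$-measure $\beta$ for $A$ (i.e. $\beta(T(y)F)=\beta(F)$ for every Borel set $F\subset\Delta(A)$ and every $y\in\mathbb{R}^N$).
   Context: $\mathcal{B}(\mathbb{R}^N)$ is the $C^*$-algebra of bounded continuous complex functions on $\mathbb{R}^N$ with the sup norm. A function $u\in\mathcal{B}(\mathbb{R}^N)$ has mean value $M(u)$ if $u(\cdot/t)\to M(u)$ weakly-* in $L^\infty(\mathbb{R}^N)$ as $t\to0^+$. An $H$-supralgebra on $\mathbb{R}^N$ is a closed subalgebra $A$ of $\mathcal{B}(\mathbb{R}^N)$ containing the constants, closed under complex conjugation, all of whose elements have a mean value. $\Delta(A)$ is the spectrum of $A$ (the set of nonzero multiplicative linear functionals on $A$ with the relative weak-* topology; it is compact), $\mathcal{G}:A\to\mathcal{C}(\Delta(A))$, $\mathcal{G}(u)(s)=s(u)$, is the Gelfand transformation (an isometric $*$-isomorphism), and the $M$-measure $\beta$ is the Radon probability measure on $\Delta(A)$ with $M(u)=\int_{\Delta(A)}\mathcal{G}(u)d\beta$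 for all $u\in A$. A continuous $N$-dimensional dynamical system on a compact space $K$ is a family of maps $T(y):K\to K$, $y\in\mathbb{R}^N$, with $T(0)=\mathrm{id}_K$, $T(x+y)=T(x)\circ T(y)$, and $(y,s)\mapsto T(y)s$ continuous from $\mathbb{R}^N\times K$ to $K$. *)

(* Defs.v *)
(* Definitions for Theorem 2.2 (H-supralgebras,
   spectrum with its weak-* topology, Gelfand transform, M-measure,
   dynamical systems). *)
From HB Require Import structures.
From mathcomp Require Import all_boot all_order all_algebra.
From mathcomp Require Import all_classical all_reals all_analysis.
From mathcomp Require Export complex.
Set Implicit Arguments.
Unset Strict Implicit.
Unset Printing Implicit Defensive.
Import Order.TTheory GRing.Theory Num.Theory.
Import numFieldNormedType.Exports.
Local Open Scope ring_scope.
Local Open Scope classical_set_scope.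

(** The complex numbers, as a numClosedFieldType, so that they get the
    canonical (norm) topology / uniform structure of MathComp-Analysis. *)
Definition CC (R : realType) : numClosedFieldType := R[i].

(** modulus of a complex number *)
Definition cmod (R : realType) (z : CC R) : R :=
  Num.sqrt (@complex.Re R z ^+ 2 + @complex.Im R z ^+ 2).

(** R^N is 'rV[R]_N.  Elements of B(R^N): bounded continuous complex functions *)
Definition bcfun (R : realType) (N : nat) (u : 'rV[R]_N -> CC R) : Prop :=
  continuous u /\ exists M : R, forall x, cmod (u x) <= M.

(** Borel sigma-algebra on R^N *)
Definition RNb (R : realType) (N : nat) := g_sigma_algebraType (@open 'rV[R]_N).

(** Half-open box prod_i [a_i, b_i) *)
Definition box (R : realType) (N : nat) (a b : 'rV[R]_N) : set 'rV[R]_N :=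
  [set x | forall i, a ord0 i <= x ord0 i < b ord0 i].

(** Lebesgue (outer) measure on R^N: infimum of the total volumes of countable
    covers by boxes; on Borel sets this is the Lebesgue measure. *)
Definition lebN (R : realType) (N : nat) (E : set (RNb R N)) : \bar R :=
  ereal_inf [set S : \bar R | exists a b : nat -> 'rV[R]_N,
    (forall k i, a k ord0 i <= b k ord0 i) /\
    (E `<=` \bigcup_k box (a k) (b k)) /\
    S = (\sum_(k <oo) (\prod_(i < N) (b k ord0 i - a k ord0 i))%:E)%E].

(** complex-valued integrability and integral w.r.t. a (positive) measure *)
Definition cintegrable d (T : measurableType d) (R : realType)
  (mu : set T -> \bar R) (f : T -> CC R) : Prop :=
  mu.-integrable setT (fun x => (@complex.Re R (f x))%:E) /\
  mu.-integrable setT (fun x => (@complex.Im R (f x))%:E).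

Definition cint d (T : measurableType d) (R : realType)
  (mu : set T -> \bar R) (f : T -> CC R) : CC R :=
  Complex (fine (\int[mu]_x (@complex.Re R (f x))%:E)%E) (fine (\int[mu]_x (@complex.Im R (f x))%:E)%E).

(** u has mean value c: u(./t) -> c weakly-* in L^oo(R^N) = (L^1(R^N))' as
    t -> 0+, i.e. for every f in L^1(R^N), int u(x/t) f(x) dx -> c int f. *)
Definition has_mean_value (R : realType) (N : nat) (u : 'rV[R]_N -> CC R)
  (c : CC R) : Prop :=
  forall f : RNb R N -> CC R, cintegrable (@lebN R N) f ->
    (fun t : R => cint (@lebN R N)
        (fun x : RNb R N => u (t^-1 *: (x : 'rV[R]_N)) * f x))
      @ (0 : R)^'+ --> c * cint (@lebN R N) f.

(** H-supralgebras on R^N *)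
Record Hsupralgebra (R : realType) (N : nat) := {
  Hset :> set ('rV[R]_N -> CC R);
  H_sub : forall u, Hset u -> bcfun u;
  H_const : forall c : CC R, Hset (fun _ => c);
  H_add : forall u v, Hset u -> Hset v -> Hset (fun x => u x + v x);
  H_scale : forall (c : CC R) u, Hset u -> Hset (fun x => c * u x);
  H_mul : forall u v, Hset u -> Hset v -> Hset (fun x => u x * v x);
  H_conj : forall u, Hset u -> Hset (fun x => (u x)^*);
  (* closed in B(R^N) for the sup norm *)
  H_closed : forall u, bcfun u ->
    (forall e : R, 0 < e -> exists v, Hset v /\ forall x, cmod (u x - v x) < e) ->
    Hset u;
  H_mean : forall u, Hset u -> exists c, has_mean_value u c }.

Definition Hpred (R : realType) (N : nat) (A : Hsupralgebra R N) :
  ('rV[R]_N -> CC R) -> Prop := Hset A.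
Coercion Hpred : Hsupralgebra >-> Funclass.

(** Nonzero multiplicative linear functionals on A.  A functional on A is
    represented by its extension by 0 outside A (so that equality of
    functionals is equality of functions). *)
Definition is_char (R : realType) (N : nat) (A : set ('rV[R]_N -> CC R))
  : set {ptws ('rV[R]_N -> CC R) -> CC R} := fun s =>
  (forall u, ~ A u -> s u = 0) /\
  (forall u v, A u -> A v -> s (fun x => u x + v x) = s u + s v) /\
  (forall (c : CC R) u, A u -> s (fun x => c * u x) = c * s u) /\
  (forall u v, A u -> A v -> s (fun x => u x * v x) = s u * s v) /\
  (exists u, A u /\ s u <> 0).

(** The spectrum Delta(A), with the relative weak-* topology
    (subspace of the product (pointwise) topology). *)
Definition Delta (R : realType) (N : nat) (A : Hsupralgebra R N) : Type :=
  set_type (@is_char R N A).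

HB.instance Definition _ (R : realType) (N : nat) (A : Hsupralgebra R N) :=
  Topological.copy (Delta A)
    (set_type (@is_char R N A)).

Definition delta0_fun (R : realType) (N : nat) (A : Hsupralgebra R N)
  (u : 'rV[R]_N -> CC R) : CC R := if `[< A u >] then u 0 else 0.

Lemma delta0_char (R : realType) (N : nat) (A : Hsupralgebra R N) :
  delta0_fun A \in @is_char R N A.
Proof.
rewrite inE /delta0_fun; split; [|split; [|split; [|split]]].
- by move=> u /asboolPn /negbTE ->.
- move=> u v Au Av; rewrite !asboolT //; exact: H_add.
- move=> c u Au; rewrite !asboolT //; exact: H_scale.
- move=> u v Au Av; rewrite !asboolT //; exact: H_mul.
- have A1 : A (fun _ => 1) by exact: (H_const A 1).
  exists (fun _ => 1); split; first exact: A1.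
  by rewrite asboolT //; apply/eqP; exact: oner_neq0.
Qed.

HB.instance Definition _ (R : realType) (N : nat) (A : Hsupralgebra R N) :=
  isPointed.Build (Delta A) (@exist _ (fun s => s \in @is_char R N A) _ (delta0_char A)).

(** Borel sets of Delta(A) *)
Definition BDelta (R : realType) (N : nat) (A : Hsupralgebra R N) :=
  g_sigma_algebraType (@open (Delta A)).

(** Gelfand transform G(u)(s) = s(u) *)
Definition gelfand (R : realType) (N : nat) (A : Hsupralgebra R N)
  (u : 'rV[R]_N -> CC R) (s : Delta A) : CC R := proj1_sig s u.
Arguments gelfand {R N} A u s.

(** Radon (= regular) Borel measures on Delta(A) *)
Definition radon (R : realType) (N : nat) (A : Hsupralgebra R N)
  (b : set (BDelta A) -> \bar R) : Prop :=
  forall E : set (BDelta A), measurable E ->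
    b E = ereal_inf [set b U | U in [set U : set (BDelta A) |
                                      @open (Delta A) U /\ E `<=` U]] /\
    b E = ereal_sup [set b K | K in [set K : set (BDelta A) |
                                      @compact (Delta A) K /\ K `<=` E]].
Arguments radon {R N} A b.

(** beta is the M-measure of A: a Radon probability measure on Delta(A) with
    M(u) = int G(u) d beta for all u in A *)
Definition M_measure (R : realType) (N : nat) (A : Hsupralgebra R N)
  (b : probability (BDelta A) R) : Prop :=
  radon A b /\ forall u, A u -> has_mean_value u (cint b (gelfand A u)).

(** homeomorphisms *)
Definition homeo (X Y : topologicalType) (f : X -> Y) : Prop :=
  continuous f /\ exists g : Y -> X, continuous g /\ cancel f g /\ cancel g f.

(** continuous N-dimensional dynamical systems on K *)
Definition dynamical_system (R : realType) (N : nat) (K : topologicalType)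
  (T : 'rV[R]_N -> K -> K) : Prop :=
  T 0 = id /\ (forall x y, T (x + y) = T x \o T y) /\
  continuous (fun p : 'rV[R]_N * K => T p.1 p.2).

(* Main.v *)
(* On an H-supralgebra [A] the inverse of a real function bounded below by a
   positive constant is again in [A], by the Neumann series.  Hence a character
   does not vanish on such functions, so it is real on real functions, positive,
   and of norm at most 1.  Composing characters with translations gives the flow
   [T]; joint continuity follows from the norm bound and uniform continuity.

   The mean value is translation invariant: testing against the indicator of
   the unit box [Q], the means of [u] and [u (. + y)] at scale [t] differ by at
   most [sup |u|] times the measure of the symmetric difference of [Q] and
   [Q + t y].  So [b] and its image under [T y] give the same integral to every
   Gelfand transform.  If [K] is compact, [U] open and [K] is in [U], rational
   expressions in elements of [A] produce a Gelfand transform between 0 and 1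
   that is close to 1 on [K] and to 0 off [U], whence
   [b K <= b (T y @^-1` U)]; regularity of [b] upgrades this to invariance. *)
Require Import Defs.
From HB Require Import structures.
From mathcomp Require Import all_boot all_order all_algebra.
From mathcomp Require Import all_classical all_reals all_analysis.
From mathcomp Require Import measurable_realfun complex ring lra.
Import Order.TTheory GRing.Theory Num.Theory.
Import numFieldNormedType.Exports.
Set Implicit Arguments.
Unset Strict Implicit.
Unset Printing Implicit Defensive.
Local Open Scope ring_scope.
Local Open Scope classical_set_scope.

(** * Complex numbers *)

Section CC.
Context {R : realType}.
Implicit Types (z w : CC R) (r : R).

Definition cRe z : R := @complex.Re R z.
Definition cIm z : R := @complex.Im R z.
Definition ofR r : CC R := Complex r 0.

Lemma CC_eq z w : cRe z = cRe w -> cIm z = cIm w -> z = w.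
Proof. by case: z => a b; case: w => c d; rewrite /cRe /cIm /= => -> ->. Qed.

Lemma cReD z w : cRe (z + w) = cRe z + cRe w.
Proof. by case: z => a b; case: w => c d. Qed.
Lemma cImD z w : cIm (z + w) = cIm z + cIm w.
Proof. by case: z => a b; case: w => c d. Qed.
Lemma cReN z : cRe (- z) = - cRe z.
Proof. by case: z. Qed.
Lemma cImN z : cIm (- z) = - cIm z.
Proof. by case: z. Qed.
Lemma cReM z w : cRe (z * w) = cRe z * cRe w - cIm z * cIm w.
Proof. by case: z => a b; case: w => c d. Qed.
Lemma cImM z w : cIm (z * w) = cRe z * cIm w + cIm z * cRe w.
Proof. by case: z => a b; case: w => c d. Qed.
Lemma cRe_ofR r : cRe (ofR r) = r. Proof. by []. Qed.
Lemma cIm_ofR r : cIm (ofR r) = 0. Proof. by []. Qed.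

Lemma conj_CC z : z^* = Complex (cRe z) (- cIm z) :> CC R.
Proof. by case: z. Qed.
Lemma cRe_conj z : cRe z^* = cRe z.
Proof. by rewrite conj_CC. Qed.
Lemma cIm_conj z : cIm z^* = - cIm z.
Proof. by rewrite conj_CC. Qed.

Lemma norm_cmod z : `|z| = ofR (cmod z).
Proof. exact: normc_def. Qed.

Lemma cmod_ge0 z : 0 <= cmod z.
Proof. exact: sqrtr_ge0. Qed.

Lemma sqr_cmod z : cmod z ^+ 2 = cRe z ^+ 2 + cIm z ^+ 2.
Proof. by rewrite sqr_sqrtr// addr_ge0// sqr_ge0. Qed.

Lemma normr_cRe_le_cmod z : `|cRe z| <= cmod z.
Proof. by rewrite -sqrtr_sqr ler_sqrt ?lerDl ?addr_ge0 ?sqr_ge0. Qed.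

Lemma normr_cIm_le_cmod z : `|cIm z| <= cmod z.
Proof. by rewrite -sqrtr_sqr ler_sqrt ?lerDr ?addr_ge0 ?sqr_ge0. Qed.

Lemma cmod_le z : cmod z <= `|cRe z| + `|cIm z|.
Proof.
rewrite -(@ler_pXn2r _ 2) ?nnegrE ?cmod_ge0 ?addr_ge0// sqr_cmod.
by rewrite sqrrD !real_normK ?num_real// lerD2r lerDl mulrn_wge0 ?mulr_ge0.
Qed.

Lemma cmodB_sym z w : cmod (z - w) = cmod (w - z).
Proof. by rewrite /cmod -opprB -/(cRe _) -/(cIm _) cReN cImN !sqrrN. Qed.

Lemma ler_cmodD z w : cmod (z + w) <= cmod z + cmod w.
Proof. by have := ler_normD z w; rewrite !norm_cmod lecE /= => /andP[]. Qed.

(** The norm of [CC R] is itself [CC R]-valued, so convergence is stated with complex radii. A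
    radius that is positive in the partial order of [CC R] has zero imaginary part, which is why
    real [e] are enough. *)
Lemma cvg_cmodP (T : Type) (F : set_system T) (FF : Filter F) (f : T -> CC R) z :
  f @ F --> z <-> forall e : R, 0 < e -> \forall t \near F, cmod (z - f t) < e.
Proof.
split=> [/cvgrPdist_lt fz e e0|fz].
  have /fz : 0 < ofR e by rewrite ltcE /= e0 eqxx.
  by apply: filterS => t; rewrite norm_cmod ltcE /= => /andP[].
apply/cvgrPdist_lt => e; rewrite ltcE /= => /andP[/eqP e1 e0].
move: (fz _ e0); apply: filterS => t tz.
by rewrite norm_cmod ltcE /= e1 eqxx.
Qed.

Lemma cRe_continuous : continuous (cRe : CC R -> R).
Proof.
move=> z; 
apply/(@cvgrPdist_lt _ _ _ (nbhs z) (@filter_filter _ _ (nbhs_pfilter z))).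
move=> e e0.
have /cvg_cmodP/(_ e e0) : (id : CC R -> CC R) w @[w --> z] --> z by exact: cvg_id.
apply: filterS => w; apply: le_lt_trans.
by rewrite -cReN -cReD normr_cRe_le_cmod.
Qed.

Lemma cIm_continuous : continuous (cIm : CC R -> R).
Proof.
move=> z; 
apply/(@cvgrPdist_lt _ _ _ (nbhs z) (@filter_filter _ _ (nbhs_pfilter z))).
move=> e e0.
have /cvg_cmodP/(_ e e0) : (id : CC R -> CC R) w @[w --> z] --> z by exact: cvg_id.
apply: filterS => w; apply: le_lt_trans.
by rewrite -cImN -cImD normr_cIm_le_cmod.
Qed.

Lemma CC_hausdorff : hausdorff_space (CC R).
Proof. exact: norm_hausdorff. Qed.

End CC.

Section ofR.
Context {R : realType}.
Implicit Types r : R.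

Lemma ofRD r r' : ofR (r + r') = ofR r + ofR r'.
Proof. by apply: CC_eq; rewrite ?cReD ?cImD ?addr0. Qed.
Lemma ofRM r r' : ofR (r * r') = ofR r * ofR r'.
Proof. by apply: CC_eq; rewrite ?cReM ?cImM /cRe /cIm /= ?mulr0 ?mul0r ?subr0 ?addr0. Qed.
Lemma ofRN r : ofR (- r) = - ofR r.
Proof. by apply: CC_eq; rewrite ?cReN ?cImN /cRe /cIm //= oppr0. Qed.
Lemma ofR1 : ofR 1 = 1 :> CC R. Proof. by []. Qed.
Lemma ofR_inj : injective (@ofR R). Proof. by move=> x y []. Qed.

Lemma cmod_ofR r : cmod (ofR r) = `|r|.
Proof. by rewrite /cmod /= expr0n addr0 sqrtr_sqr. Qed.

Lemma ofR_continuous : continuous (@ofR R).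
Proof.
move=> r; apply/(@cvg_cmodP _ _ (nbhs r)) => e e0.
have /cvgrPdist_lt/(_ e e0) : id x @[x --> r] --> r by exact: cvg_id.
by apply: filterS => x; rewrite -ofRN -ofRD cmod_ofR.
Qed.

End ofR.

(** * Lebesgue measure on R^N *)

Section box_cover.
Context {R : realType}.
Local Notation mu := (@lebesgue_measure R).

(* Integrating a pointwise cover inequality one coordinate at a time reduces
   the lower bound for the volume of a box to the one-dimensional measure. *)
Lemma prod_le_nneseries_of_cover n (a b : 'I_n -> R) (c : nat -> R)
    (A B : nat -> 'I_n -> R) :
  (forall i, a i <= b i) -> (forall k i, A k i <= B k i) ->
  (forall k, 0 <= c k) ->
  (forall x : 'I_n -> R, (forall i, a i <= x i < b i) ->
    (1 <= \sum_(k <oo) (c k * \prod_i \1_(`[A k i, B k i[) (x i))%:E)%E) ->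
  ((\prod_i (b i - a i))%:E <=
    \sum_(k <oo) (c k * \prod_i (B k i - A k i))%:E)%E.
Proof.
elim: n a b c A B => [|n IHn] a b c A B ab AB c0 cover.
  rewrite big_ord0; apply: le_trans (cover (fun=> 0) _) _; first by case.
  rewrite le_eqVlt; apply/orP; left; apply/eqP/eq_eseriesr => k _.
  by rewrite !big_ord0.
pose P := \prod_(i < n) (b (lift ord0 i) - a (lift ord0 i)).
pose Q k := \prod_(i < n) (B k (lift ord0 i) - A k (lift ord0 i)).
have P0 : 0 <= P by apply: prodr_ge0 => i _; rewrite subr_ge0.
have Q0 k : 0 <= Q k by apply: prodr_ge0 => i _; rewrite subr_ge0.
pose D : set (measurableTypeR R) := `[a ord0, b ord0[%classic.
(* With the first coordinate frozen at [t], the indicator of the first edge of box [k] becomes part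
   of the weight. The weights [c] are carried so that the induction hypothesis can absorb this
   factor. *)
have slice t : D t ->
    (P%:E <= \sum_(k <oo) (c k * \1_(`[A k ord0, B k ord0[) t * Q k)%:E)%E.
  move=> Dt; apply: IHn => [i|k i|k|x abx] //; first by rewrite mulr_ge0.
  pose x' (i : 'I_n.+1) := if unlift ord0 i is Some j then x j else t.
  have abx' i : a i <= x' i < b i.
    rewrite /x'; case: unliftP => [j ->|->]; first exact: abx.
    by move: Dt; rewrite /D /= inE.
  apply: le_trans (cover x' abx') _; rewrite le_eqVlt; apply/orP; left.
  apply/eqP/eq_eseriesr => k _; rewrite big_ord_recl {1}/x' unlift_none mulrA.
  by congr (_ * _)%:E; apply: eq_bigr => i _; rewrite /x' liftK.
have volD (r s : R) : r <= s -> mu `[r, s[ = (s - r)%:E.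
  move=> rs; rewrite lebesgue_measure_itv /= lte_fin.
  by case: ltP => // sr; rewrite (@le_anti _ _ r s) ?subrr// rs.
have mD : measurable D by exact: measurable_itv.
have : (\int[mu]_(t in D) P%:E <= \int[mu]_(t in D)
    \sum_(k <oo) (c k * \1_(`[A k ord0, B k ord0[) t * Q k)%:E)%E.
  apply: ge0_le_integral => //=.
  apply: (@ge0_emeasurable_sum _ _ _ _ _ xpredT) => [k x _ _|k _].
    by rewrite lee_fin !mulr_ge0.
  apply/measurable_EFinP; apply: measurable_funM => //.
  by apply: measurable_funM => //; exact: measurable_indic.
rewrite integral_cst//= volD// -EFinM integral_nneseries//; last 2 first.
- move=> k; apply/measurable_EFinP; apply: measurable_funM => //.
  by apply: measurable_funM => //; exact: measurable_indic.
- by move=> k x _; rewrite lee_fin !mulr_ge0.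
rewrite big_ord_recl mulrC => /le_trans; apply; apply: lee_nneseries => k _.
  by move=> _; apply: integral_ge0 => x _; rewrite lee_fin !mulr_ge0.
rewrite big_ord_recl -/(Q k).
under eq_integral do rewrite mulrAC EFinM.
rewrite ge0_integralZl//=; last 2 first.
- by apply/measurable_EFinP; exact: measurable_indic.
- by rewrite lee_fin mulr_ge0.
have -> : (c k * ((B k ord0 - A k ord0) * Q k))%:E =
    ((c k * Q k)%:E * (B k ord0 - A k ord0)%:E)%E.
  by rewrite -EFinM; congr (_%:E); ring.
apply: lee_wpmul2l; first by rewrite lee_fin mulr_ge0.
rewrite integral_indic//= -volD//; apply: le_measure; rewrite ?inE//.
exact: measurableI.
Qed.

End box_cover.

(** * The box-covering outer measure and the volume of boxes *)

Section lebN.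
Context {R : realType} {n : nat}.
Local Notation N := n.+1.
Local Notation RN := (RNb R N).
Local Notation lambda := (@lebN R N).
Implicit Types (X Y : set RN) (a b : 'rV[R]_N).

Definition vol a b : R := \prod_(i < N) (b ord0 i - a ord0 i).

Lemma vol_ge0 a b : (forall i, a ord0 i <= b ord0 i) -> 0 <= vol a b.
Proof. by move=> ab; apply: prodr_ge0 => i _; rewrite subr_ge0. Qed.

(** The first factor vanishes; positive dimension matters here, an empty product being 1. *)
Lemma vol_diag a : vol a a = 0.
Proof. by rewrite /vol big_ord_recl subrr mul0r. Qed.

Lemma lebN_le_nneseries X (a b : nat -> 'rV[R]_N) :
  (forall k i, a k ord0 i <= b k ord0 i) ->
  X `<=` \bigcup_k box (a k) (b k) ->
  (lambda X <= \sum_(k <oo) (vol (a k) (b k))%:E)%E.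
Proof. by move=> ab Xab; apply: ereal_inf_lbound; exists a, b. Qed.

Lemma le_lebN_of_covers X (r : \bar R) :
  (forall a b : nat -> 'rV[R]_N, (forall k i, a k ord0 i <= b k ord0 i) ->
    X `<=` \bigcup_k box (a k) (b k) ->
    (r <= \sum_(k <oo) (vol (a k) (b k))%:E)%E) ->
  (r <= lambda X)%E.
Proof.
by move=> h; apply: le_ereal_inf_tmp => _ [a [b [ab [Xab ->]]]]; exact: h.
Qed.

Lemma lebN_ge0 X : (0 <= lambda X)%E.
Proof.
apply: le_lebN_of_covers => a b ab _; apply: nneseries_ge0 => k _ _.
by rewrite lee_fin vol_ge0.
Qed.

Lemma le_lebN : {homo lambda : X Y / X `<=` Y >-> (X <= Y)%E}.
Proof.
move=> X Y XY; apply: le_lebN_of_covers => a b ab Yab.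
by apply: lebN_le_nneseries => //; exact: subset_trans Yab.
Qed.

Lemma lebN_box_le a b : (forall i, a ord0 i <= b ord0 i) ->
  (lambda (box a b) <= (vol a b)%:E)%E.
Proof.
(* Covers are infinite sequences, so the box itself is padded with degenerate boxes [box a a] of
   volume 0. *)
move=> ab; pose c k : 'rV[R]_N := if k is 0%N then b else a.
apply: le_trans (@lebN_le_nneseries _ (fun=> a) c _ _) _.
- by case.
- by move=> x abx; exists 0%N.
- rewrite nneseries_recl//; last by case => [|k]; rewrite lee_fin vol_ge0.
  rewrite eseries_cond eseries0 ?adde0// => -[//|k] _ _.
  by rewrite /= vol_diag.
Qed.

Lemma lebN0 : lambda set0 = 0%E.
Proof.
apply/eqP; rewrite eq_le lebN_ge0 andbT.
apply: le_trans (le_lebN (sub0set (box 0 0))) _.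
by apply: le_trans (lebN_box_le _) _ => //; rewrite vol_diag.
Qed.

(** When all terms are finite, each [F k] gets a cover of total volume within [e / 2 ^ k.+1] of
    [lambda (F k)]. A bijection [f] from [nat] to pairs merges these covers into one sequence, and
    the excesses sum to at most [e]. *)
Lemma lebN_sigma_subadditive : sigma_subadditive lambda.
Proof.
move=> F; have [[i Fi]|] := pselect (exists i, lambda (F i) = +oo%E).
  rewrite (eseries_pinfty _ _ Fi) ?leey// => k _.
  by rewrite -ltNye (lt_le_trans _ (lebN_ge0 _)).
rewrite -forallNE => Ffin; apply/lee_addgt0Pr => e e0.
apply: le_trans (epsilon_trick _ _ (ltW e0)); last by move=> k; exact: lebN_ge0.
pose P k (ab : (nat -> 'rV[R]_N) * (nat -> 'rV[R]_N)) :=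
  [/\ forall j i, ab.1 j ord0 i <= ab.2 j ord0 i,
     F k `<=` \bigcup_j box (ab.1 j) (ab.2 j) &
     (\sum_(j <oo) (vol (ab.1 j) (ab.2 j))%:E <=
       lambda (F k) + (e / (2 ^ k.+1)%:R)%:E)%E].
have [G PG] : {G : _ & forall k, P k (G k)}.
  apply: (@choice _ _ P) => k.
  have ek : 0 < e / (2 ^ k.+1)%:R by rewrite divr_gt0// ltr0n expn_gt0.
  have fin : lambda (F k) \is a fin_num.
    by rewrite ge0_fin_numE ?lebN_ge0// ltey; apply/eqP/Ffin.
  have [_ [a [b [ab [Fab ->]]]] /ltW lt] := lb_ereal_inf_adherent ek fin.
  by exists (a, b).
pose a := (fun kj : nat * nat => (G kj.1).1 kj.2).
pose b := (fun kj : nat * nat => (G kj.1).2 kj.2).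
pose v kj := (vol (a kj) (b kj))%:E.
have ab kj i : a kj ord0 i <= b kj ord0 i by have [h _ _] := PG kj.1; exact: h.
have v0 kj : (0 <= v kj)%E by rewrite lee_fin vol_ge0.
apply: (@le_trans _ _ (\esum_(kj in setT) v kj)).
  have /card_esym/ppcard_eqP[f] := card_nat2.
  rewrite -[X in esum X](@image_eq _ _ _ _ f) -[X in image X]set_true.
  rewrite esum_pred_image//; last first.
    by move=> x y _ _; have /= := 'inj_f; apply; rewrite inE.
  apply: (@lebN_le_nneseries _ (a \o f) (b \o f)) => [k i|x [k _ Fkx]]; first exact: ab.
  have [_ Fk _] := PG k; have [j _ jx] := Fk x Fkx.
  by exists (f^-1%FUN (k, j)) => //=; rewrite /a /b invK ?inE.
rewrite (_ : esum _ _ = \sum_(k <oo) \sum_(j <oo) v (k, j))%E.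
  apply: lee_nneseries => [k _ _|k _]; first exact: nneseries_ge0.
  by have [] := PG k.
(* The rows [J k] partition the pairs, which turns the unordered sum into an iterated series. *)
pose J k : set (nat * nat) := [set (k, j) | j in setT].
rewrite (_ : setT = \bigcup_k J k); last first.
  by rewrite predeqE => -[x y]; split => // _; exists x => //; exists y.
rewrite esum_bigcupT//=; last first.
  apply/trivIsetP => i j _ _ ij; rewrite predeqE => -[x y]; split => //= -[].
  by move=> [u _ [ux _]] [w _ [wx _]]; move: ij; rewrite ux wx eqxx.
rewrite -(image_id [set: nat]) -fun_true esum_pred_image//; last first.
  by move=> k _; exact: esum_ge0.
apply: eq_eseriesr => k _.
rewrite -(esum_pred_image v (pair k) predT)//=; last first.
  by move=> ? ? _ _; exact: (@can_inj _ _ _ snd).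
by congr esum; rewrite predeqE => -[x y]; split; move=> [i _ <-]; exists i.
Qed.

HB.instance Definition _ := isOuterMeasure.Build R RN lambda
  lebN0 lebN_ge0 le_lebN lebN_sigma_subadditive.

(** For the lower bound, each point of the box lies in some covering box, whose product of edge
    indicators is 1 there. The indicators of a cover thus sum to at least 1 on the box, and
    [prod_le_nneseries_of_cover] applies with all weights 1. *)
Lemma lebN_box a b : (forall i, a ord0 i <= b ord0 i) ->
  lambda (box a b) = (vol a b)%:E.
Proof.
move=> ab; apply/eqP; rewrite eq_le lebN_box_le//=.
apply: le_lebN_of_covers => A B AB cover.
rewrite [leRHS](_ : _ = \sum_(k <oo)
    (1 * \prod_i (B k ord0 i - A k ord0 i))%:E)%E; last first.
  by apply: eq_eseriesr => k _; rewrite mul1r.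
apply: (@prod_le_nneseries_of_cover R N (a ord0) (b ord0) (fun=> 1)
  (fun k => A k ord0) (fun k => B k ord0)) => // x abx.
have [|k _ kx] := cover (\row_i x i).
  by move=> i; rewrite mxE.
rewrite (nneseries_split _ k.+1); last first.
  by move=> j _; rewrite lee_fin mul1r prodr_ge0// => i _; rewrite lee_fin.
rewrite big_nat_recr//= -[leLHS]adde0 leeD//.
  rewrite -[leLHS]add0e; apply: leeD.
    by apply: sume_ge0 => j _; rewrite lee_fin mul1r prodr_ge0.
  rewrite mul1r big1// => i _; rewrite indicE mem_set//.
  by have := kx i; rewrite mxE /= in_itv.
by apply: nneseries_ge0 => j _ _; rewrite lee_fin mul1r prodr_ge0.
Qed.

End lebN.

(** * Borel measurability of continuous maps *)

Section continuous_borel.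
Context {T : ptopologicalType}.
Local Notation BT := (g_sigma_algebraType (@open T)).

Lemma continuous_borel_measurable (T' : ptopologicalType) (f : T -> T') :
  continuous f ->
  measurable_fun [set: BT] (f : BT -> g_sigma_algebraType (@open T')).
Proof.
move=> /continuousP cf.
apply: (@measurability _ _ BT (g_sigma_algebraType (@open T')) _ _ (@open T')) => //.
by move=> _ [U oU <-]; rewrite setTI; apply: sub_sigma_algebra; exact: cf.
Qed.

(** Stated apart because [R] comes with its own sigma-algebra; it is generated by open intervals,
    whose preimages are open. *)
Lemma continuous_borel_measurable_real (R : realType) (f : T -> R) :
  continuous f -> measurable_fun [set: BT] (f : BT -> R).
Proof.
move=> /continuousP cf; apply: (measurability _ (RGenOpens.measurableE R)).
move=> _ [_ [x [y ->]] <-]; rewrite setTI; apply: sub_sigma_algebra.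
by apply: cf; exact: interval_open.
Qed.

End continuous_borel.

(** * Caratheodory measurability of Borel sets, and translation invariance of the measure *)

Section lebN_measure.
Context {R : realType} {n : nat}.
Local Notation N := n.+1.
Local Notation RN := (RNb R N).
Local Notation lambda := (@lebN R N).
Implicit Types (X Y : set RN) (a b : 'rV[R]_N).

Definition halfspace (i : 'I_N) (c : R) : set 'rV[R]_N := [set x | x ord0 i < c].

Definition set_coord (i : 'I_N) (v : 'rV[R]_N) (r : R) : 'rV[R]_N :=
  \row_j if j == i then r else v ord0 j.

Lemma vol_split i a b (r s : R) :
  r - a ord0 i + (b ord0 i - s) = b ord0 i - a ord0 i ->
  vol a (set_coord i b r) + vol (set_coord i a s) b = vol a b.
Proof.
move=> h; rewrite /vol (bigD1 i)//= [X in _ + X](bigD1 i)//= [RHS](bigD1 i)//=.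
have -> : \prod_(j < N | j != i) (set_coord i b r ord0 j - a ord0 j) =
    \prod_(j < N | j != i) (b ord0 j - a ord0 j).
  by apply: eq_bigr => j /negbTE ji; rewrite mxE ji.
have -> : \prod_(j < N | j != i) (b ord0 j - set_coord i a s ord0 j) =
    \prod_(j < N | j != i) (b ord0 j - a ord0 j).
  by apply: eq_bigr => j /negbTE ji; rewrite mxE ji.
by rewrite !mxE eqxx -mulrDl h.
Qed.

(** Cut every box of a cover of [X] along the hyperplane: the lower pieces cover the part of [X] in
    the half-space, the upper ones cover the rest, and by [vol_split] no volume is gained. *)
Lemma caratheodory_halfspace i c : lambda.-caratheodory (halfspace i c).
Proof.
apply: le_caratheodory_measurable => X; apply: le_lebN_of_covers => a b ab Xab.
(* Both [r k] and [s k] are [c] clamped to the [i]-th edge of box [k], so the pieces keep ordered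
   corners even when the hyperplane misses the box. The two forms make [a <= r] and [s <= b]
   immediate. *)
pose r k := Order.max (a k ord0 i) (Order.min (b k ord0 i) c).
pose s k := Order.min (b k ord0 i) (Order.max (a k ord0 i) c).
have rs k : r k - a k ord0 i + (b k ord0 i - s k) = b k ord0 i - a k ord0 i.
  rewrite /r /s; have := ab k i.
  by case: (ltP (b k ord0 i) c); case: (ltP (a k ord0 i) c) => *;
     rewrite ?maxEle ?minEle; do ?case: ifPn; rewrite -?ltNge => *; lra.
have ar k j : a k ord0 j <= set_coord i (b k) (r k) ord0 j.
  by rewrite mxE; case: eqP => [->|_]; rewrite ?ab// le_max lexx.
have sb k j : set_coord i (a k) (s k) ord0 j <= b k ord0 j.
  by rewrite mxE; case: eqP => [->|_]; rewrite ?ab// ge_min lexx.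
under eq_eseriesr do rewrite -(vol_split (rs _)) EFinD.
rewrite nneseriesD; try by move=> k _ _; rewrite lee_fin vol_ge0.
apply: leeD; apply: lebN_le_nneseries => //.
- move=> x [Xx xc]; have [k _ kx] := Xab x Xx; exists k => // j.
  rewrite mxE; have /andP[-> xb] := kx j; case: eqP => [ji|_] //=.
  by rewrite lt_max lt_min -ji xb ji xc orbT.
- move=> x [Xx /negP xc]; have [k _ kx] := Xab x Xx; exists k => // j.
  rewrite mxE; have /andP[ax ->] := kx j; rewrite andbT; case: eqP => [ji|_] //=.
  by move: ax; rewrite ji => ax; rewrite ge_min ge_max ax (leNgt c) xc orbT.
Qed.

Lemma boxE a b : box a b = \bigcap_i (halfspace i (b ord0 i) `\` halfspace i (a ord0 i)).
Proof.
apply/seteqP; split => [x abx i _|x abx i].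
  by have /andP[ax xb] := abx i; split => //; rewrite /halfspace /= ltNge ax.
by have [xb /negP] := abx i I; rewrite /halfspace /= in xb *; rewrite -leNgt xb => ->.
Qed.

Lemma caratheodory_box a b : lambda.-caratheodory (box a b).
Proof.
rewrite boxE; pose H i := halfspace i (b ord0 i) `\` halfspace i (a ord0 i).
suff : (measurable (\bigcap_(i in [set: 'I_N])
  (H i : set (caratheodory_type lambda)))) by [].
apply: fin_bigcap_measurable => // i _.
by apply: measurableD; exact: caratheodory_halfspace.
Qed.

(** The pieces are the cubes with rational centre and half-width [1 / m.+1] contained in [U],
    enumerated through [unpickle]; codes of other cubes, or of nothing, yield the empty set. *)
Lemma open_bigcup_box (U : set 'rV[R]_N) : open U ->
  exists F : nat -> set 'rV[R]_N,
    (forall k, F k = set0 \/ exists a b, F k = box a b) /\ U = \bigcup_k F k.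
Proof.
move=> oU.
pose C (qm : 'rV[rat]_N * nat) :=
  box (\row_i (ratr (qm.1 ord0 i) - qm.2.+1%:R^-1) : 'rV[R]_N)
      (\row_i (ratr (qm.1 ord0 i) + qm.2.+1%:R^-1)).
pose F k := if unpickle k is Some qm then
              if `[< C qm `<=` U >] then C qm else set0
            else set0.
exists F; split => [k|].
  rewrite /F; case: unpickle => [qm|]; last by left.
  by case: ifP => _; [right; do 2 eexists|left].
apply/seteqP; split => [x Ux|x [k _]]; last first.
  by rewrite /F; case: unpickle => // qm; case: ifPn => // /asboolP; exact.
have /nbhs_ballP[e /= e0 xe] : nbhs x U by exact: open_nbhs_nbhs.
(* Two points of a cube of half-width [1 / m.+1] differ in each coordinate by less than twice that,
   hence by less than [e]. *)
have [m me] : exists m : nat, m.+1%:R^-1 < e / 2.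
  have [m _ /(_ _ (leqnn m))] :=
    near_infty_natSinv_lt (PosNum (divr_gt0 e0 (ltr0Sn _ 1))).
  by exists m.
have [q xq] : {q : 'I_N -> rat & forall i,
    x ord0 i - m.+1%:R^-1 < ratr (q i) < x ord0 i + m.+1%:R^-1}.
  apply: (@choice _ _ (fun i q =>
    x ord0 i - m.+1%:R^-1 < ratr q < x ord0 i + m.+1%:R^-1)) => i.
  have /rat_in_itvoo[q] : x ord0 i - m.+1%:R^-1 < x ord0 i + m.+1%:R^-1.
    by rewrite ltrD2l gt0_cp ?invr_gt0.
  by rewrite in_itv; exists q.
exists (pickle (\row_i q i, m)) => //.
have m0 : 0 < m.+1%:R^-1 :> R by rewrite invr_gt0.
rewrite /F pickleK asboolT.
  move=> i; rewrite /= !mxE; have := xq i.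
  by move: (ratr (q i)) (m.+1%:R^-1) => z d; lra.
move=> y Cy; apply: xe; split => // i j; rewrite (ord1 i).
have := Cy j; rewrite /= !mxE /ball /= ltr_norml; have := xq j; move: me.
by move: (ratr (q j)) (m.+1%:R^-1) => z d; lra.
Qed.

Lemma caratheodory_open (U : set RN) : @open 'rV[R]_N U -> lambda.-caratheodory U.
Proof.
move=> /open_bigcup_box[F [HF ->]]; apply: caratheodory_measurable_bigcup => k.
have [->|[a [b ->]]] := HF k; last exact: caratheodory_box.
exact: caratheodory_measurable_set0.
Qed.

Lemma measurable_caratheodory X : measurable X -> lambda.-caratheodory X.
Proof.
move: X; apply: smallest_sub; last exact: caratheodory_open.
exact: (@sigma_algebra_measurable _ (caratheodory_type lambda)).
Qed.

Lemma lebN_semi_sigma_additive : semi_sigma_additive lambda.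
Proof.
move=> F mF tF mUF; apply: (@caratheodory_measure_sigma_additive R RN lambda) => //.
- by move=> k; exact: measurable_caratheodory.
- exact: measurable_caratheodory.
Qed.

HB.instance Definition _ := isMeasure.Build _ RN R lambda
  lebN0 lebN_ge0 lebN_semi_sigma_additive.

(** Translating a cover preserves volumes, which gives one inequality for every shift; the other
    follows by applying it to the opposite shift. *)
Lemma lebN_preimage_shift (h : 'rV[R]_N) X :
  lambda ((fun x : 'rV[R]_N => x + h) @^-1` X) = lambda X.
Proof.
suff le (k : 'rV[R]_N) Y : (lambda ((fun x : 'rV[R]_N => x + k)%R @^-1` Y) <= lambda Y)%E.
  apply/eqP; rewrite eq_le le /=.
  have {1}-> : X = (fun x : 'rV[R]_N => x + - h) @^-1`
      ((fun x : 'rV[R]_N => x + h) @^-1` X).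
    by apply/seteqP; split => x /=; rewrite subrK.
  exact: le.
apply: le_lebN_of_covers => a b ab Yab.
have -> : (\sum_(j <oo) (vol (a j) (b j))%:E =
    \sum_(j <oo) (vol (a j - k) (b j - k))%:E)%E.
  apply: eq_eseriesr => j _; congr (_%:E); apply: eq_bigr => i _; rewrite !mxE; ring.
apply: lebN_le_nneseries => [j i|x /Yab[j _ jx]]; first by rewrite !mxE lerD2r.
by exists j => // i; rewrite !mxE; have := jx i; rewrite mxE; lra.
Qed.

Lemma open_halfspace i c : open (halfspace i c).
Proof.
have -> : halfspace i c = (fun x : 'rV[R]_N => x ord0 i) @^-1` `]-oo, c[.
  by apply/seteqP; split => x /=; rewrite /halfspace /= in_itv.
by move/continuousP : (@coord_continuous R 1 N ord0 i); apply; exact: interval_open.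
Qed.

Lemma measurable_box a b : measurable (box a b : set RN).
Proof.
rewrite boxE; apply: fin_bigcap_measurable => // i _.
by apply: measurableD; apply: sub_sigma_algebra; exact: open_halfspace.
Qed.

End lebN_measure.

(** * Translation invariance of the mean value *)

Section mean_shift.
Context {R : realType} {n : nat}.
Local Notation N := n.+1.
Local Notation RN := (RNb R N).
Local Notation lambda := (@lebN R N).
Implicit Types (X Y : set RN) (a b : 'rV[R]_N).

Lemma integrable_indic_box a b : (forall i, a ord0 i <= b ord0 i) ->
  lambda.-integrable setT (EFin \o (\1_(box a b) : RN -> R)).
Proof.
move=> ab; have mb := measurable_box a b.
apply/integrableP; split.
  by apply/measurable_EFinP; exact: measurable_indic.
under eq_integral do rewrite /= ger0_norm//.
by rewrite integral_indic//= setIT lebN_box// ltry.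
Qed.

Lemma Rintegral_indic_box a b : (forall i, a ord0 i <= b ord0 i) ->
  Rintegral lambda setT (\1_(box a b) : RN -> R) = vol a b.
Proof.
move=> ab; have mb := measurable_box a b.
by rewrite /Rintegral integral_indic//= setIT lebN_box.
Qed.

Lemma integrable_bounded_indic_box (g : RN -> R) (C : R) a b :
  (forall i, a ord0 i <= b ord0 i) -> measurable_fun setT g ->
  (forall x, `|g x| <= C) ->
  lambda.-integrable setT (EFin \o (fun x => g x * \1_(box a b) x)).
Proof.
move=> ab mg gC; have mb := measurable_box a b.
apply: (@le_integrable _ _ _ lambda _ _ _ (fun x => C%:E * (\1_(box a b) x)%:E)%E) => //.
- by apply/measurable_EFinP; apply: measurable_funM => //; exact: measurable_indic.
- move=> x _; rewrite /= lee_fin !normrM ler_wpM2r//.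
  by rewrite (le_trans (gC x))// ler_norm.
- by apply: integrableZl => //; exact: integrable_indic_box.
Qed.

Lemma measurable_shift (h : 'rV[R]_N) :
  measurable_fun [set: RN] (fun x : RN => (x : 'rV[R]_N) + h : RN).
Proof.
apply: (@continuous_borel_measurable 'rV[R]_N 'rV[R]_N (fun x => x + h)) => x.
by apply: (@cvgD R 'rV[R]_N 'rV[R]_N (nbhs x) _ id (fun=> h) x h);
  [exact: cvg_id|exact: cvg_cst].
Qed.

(** Change of variables: the image of [lambda] under the translation is [lambda] again. *)
Lemma integral_shift (h : 'rV[R]_N) (f : RN -> \bar R) :
  measurable_fun setT f ->
  lambda.-integrable setT (fun x : RN => f ((x : 'rV[R]_N) + h)%R) ->
  (\int[lambda]_x f ((x : 'rV[R]_N) + h : RN)%R = \int[lambda]_x f x)%E.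
Proof.
move=> mf intf.
have := @integral_pushforward _ _ RN RN R _ (measurable_shift h) lambda setT f
  mf intf measurableT.
rewrite preimage_setT => <-; apply: eq_measure_integral => [|mshift A mA _].
  exact: measurable_shift.
exact: lebN_preimage_shift.
Qed.

Definition unit_box : set 'rV[R]_N := box 0 (const_mx 1).

Lemma Rintegral_unit_box : Rintegral lambda setT (\1_unit_box : RN -> R) = 1.
Proof.
rewrite Rintegral_indic_box => [|i]; last by rewrite !mxE.
by rewrite /vol big1// => i _; rewrite !mxE subr0.
Qed.

(** Moving the shift from [g] to the box leaves the integral of [g * (1_Qh - 1_Q)], where [Qh] is
    [Q] translated by [h]. The smaller cube [P] lies in both, so the absolute difference of
    indicators is at most [1_Qh + 1_Q - 2 * 1_P], whose integral is [2 - 2 * (1 - 2 * d) ^+ N]. *)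
Lemma Rintegral_shift_unit_box_le (g : RN -> R) (C d : R) (h : 'rV[R]_N) :
  measurable_fun setT g -> (forall x, `|g x| <= C) ->
  d <= 2^-1 -> (forall i, `|h ord0 i| <= d) ->
  `|Rintegral lambda setT (fun x : RN => g ((x : 'rV[R]_N) + h) * \1_unit_box x) -
    Rintegral lambda setT (fun x => g x * \1_unit_box x)|
  <= C * (2 - 2 * (1 - 2 * d) ^+ N).
Proof.
move=> mg gC d2 hd.
have C0 : 0 <= C by exact: le_trans (gC 0).
have hd' i : - d <= h ord0 i <= d by rewrite -ler_norml.
pose Q := unit_box; pose Qh : set 'rV[R]_N := box h (h + const_mx 1).
(* The unit cube shrunk by [d] on every side; [d <= 2^-1] keeps its corners ordered. *)
pose P : set 'rV[R]_N := box (const_mx d) (const_mx (1 - d)).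
have hQ i : (0 : 'rV[R]_N) ord0 i <= (const_mx 1 : 'rV[R]_N) ord0 i by rewrite !mxE.
have hQh i : h ord0 i <= (h + const_mx 1) ord0 i by rewrite !mxE lerDl.
have hP i : (const_mx d : 'rV[R]_N) ord0 i <= (const_mx (1 - d) : 'rV[R]_N) ord0 i.
  by rewrite !mxE; lra.
have QhE (x : 'rV[R]_N) : \1_Qh (x + h) = \1_Q x :> R.
  rewrite !indicE; congr (_%:R); congr nat_of_bool.
  by apply/asboolP/asboolP => xx i; have := xx i; rewrite !mxE; lra.
have vQ : Rintegral lambda setT (\1_Q : RN -> R) = 1 := Rintegral_unit_box.
have vQh : Rintegral lambda setT (\1_Qh : RN -> R) = 1.
  rewrite Rintegral_indic_box// /vol big1// => i _; rewrite !mxE; ring.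
have vP : Rintegral lambda setT (\1_P : RN -> R) = (1 - 2 * d) ^+ N.
  rewrite Rintegral_indic_box// /vol -[N in RHS]card_ord -prodr_const.
  by apply: eq_bigr => i _; rewrite !mxE; ring.
have iQ := integrable_indic_box hQ.
have iQh := integrable_indic_box hQh.
have iP := integrable_indic_box hP.
have igQ := integrable_bounded_indic_box hQ mg gC.
have igQh := integrable_bounded_indic_box hQh mg gC.
have -> : Rintegral lambda setT (fun x : RN => g ((x : 'rV[R]_N) + h) * \1_unit_box x) =
    Rintegral lambda setT (fun x => g x * \1_Qh x).
  rewrite /Rintegral; congr fine.
  rewrite -(@integral_shift h (fun x => (g x * \1_Qh x)%:E)).
  - by apply: eq_integral => x _; rewrite QhE.
  - by have /integrableP[] := igQh.
  - under eq_fun do rewrite QhE.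
    apply: (@integrable_bounded_indic_box (fun x : RN => g ((x : 'rV[R]_N) + h)) C) => //.
    by apply: (measurableT_comp mg); exact: measurable_shift.
rewrite -RintegralB//.
apply: le_trans (le_normr_Rintegral _ _) _ => //.
  exact: (integrableB measurableT igQh igQ).
have iD : lambda.-integrable setT
    (EFin \o (fun x : RN => \1_Qh x + \1_Q x - 2 * \1_P x : R)).
  apply: (@integrableB _ _ _ lambda _ _ (EFin \o (fun x : RN => \1_Qh x + \1_Q x : R))
    (EFin \o (fun x : RN => 2 * \1_P x : R))) => //.
    exact: (integrableD measurableT iQh iQ).
  exact: (integrableZl measurableT 2 iP).
apply: (@le_trans _ _ (Rintegral lambda setT
  (fun x : RN => C * (\1_Qh x + \1_Q x - 2 * \1_P x)))).
  apply: le_Rintegral => //.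
  - apply: (@integrable_norm _ _ _ lambda _
      (fun x : RN => g x * \1_Qh x - g x * \1_unit_box x)).
    exact: (integrableB measurableT igQh igQ).
  - exact: (integrableZl measurableT C iD).
  - move=> x _ /=; rewrite -mulrBr normrM; apply: ler_pM => //.
    have PQ : P x -> Q x.
      by move=> Px i; have := Px i; have := hd' i; rewrite !mxE; lra.
    have PQh : P x -> Qh x.
      by move=> Px i; have := Px i; have := hd' i; rewrite !mxE; lra.
    rewrite !indicE.
    case: (asboolP (P x)) => Px.
      rewrite -/Q (mem_set Px) (mem_set (PQ Px)) (mem_set (PQh Px)) /=.
      by rewrite subrr normr0; lra.
    rewrite [x \in P]memNset//= mulr0 subr0.
    by case: (x \in Qh); case: (x \in Q);
      rewrite /= ?subrr ?subr0 ?sub0r ?normrN ?normr0 ?normr1; lra.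
rewrite RintegralZl// RintegralB//; last 2 first.
- exact: (integrableD measurableT iQh iQ).
- exact: (integrableZl measurableT 2 iP).
rewrite RintegralD// RintegralZl// vQ vQh vP.
by rewrite ler_wpM2l//; lra.
Qed.

Lemma shift_modulus_cvg0 (C Y : R) :
  (fun t : R => C * (2 - 2 * (1 - 2 * (t * Y)) ^+ N)) @ (0 : R)^'+ --> (0 : R).
Proof.
apply: cvg_at_right_filter.
have c : continuous (fun t : R => C * (2 - 2 * (1 - 2 * (t * Y)) ^+ N)).
  move=> t; apply: cvgM; first exact: cvg_cst.
  apply: cvgB; first exact: cvg_cst.
  apply: cvgM; first exact: cvg_cst.
  apply: (@continuous_comp R R R (fun s => 1 - 2 * (s * Y)) (fun s => s ^+ N) t);
    last exact: exprn_continuous.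
  apply: cvgB; first exact: cvg_cst.
  apply: cvgM; first exact: cvg_cst.
  by apply: cvgM; [exact: cvg_id|exact: cvg_cst].
by have := c 0; rewrite /continuous_at mul0r mulr0 subr0 expr1n mulr1 subrr mulr0.
Qed.

(** Since [t^-1 *: x + y = t^-1 *: (x + t *: y)], translating [u] by [y] amounts at scale [t] to a
    displacement by [t *: y], which vanishes in the limit. *)
Lemma mean_value_shift (u : 'rV[R]_N -> CC R) (y : 'rV[R]_N) (c c' : CC R) :
  bcfun u -> has_mean_value u c -> has_mean_value (fun x => u (x + y)) c' ->
  c = c'.
Proof.
move=> [cu [C uC]] hc hc'.
pose f : RN -> CC R := fun x => ofR (\1_unit_box x).
have u01 i : (0 : 'rV[R]_N) ord0 i <= (const_mx 1 : 'rV[R]_N) ord0 i by rewrite !mxE.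
have intf : cintegrable lambda f.
  by split; [exact: integrable_indic_box|exact: integrable0].
have cf : cint lambda f = 1.
  by rewrite /cint /f /= -/(Rintegral _ _ _) Rintegral_unit_box integral0.
move: (hc f intf) (hc' f intf); rewrite cf !mulr1.
set I := (fun t : R => cint _ _); set J := (fun t : R => cint _ _) => cI cJ.
(* [t * Y] bounds every coordinate of the displacement [t *: y]; it serves as [d] in the box
   estimate once [t] is small enough to make it at most 1/2. *)
pose Y := \sum_i `|y ord0 i|.
have Y0 : 0 <= Y by exact: sumr_ge0.
have yY i : `|y ord0 i| <= Y by rewrite /Y (bigD1 i)//= lerDl sumr_ge0.
have IJ : (fun t => J t - I t) @ (0 : R)^'+ --> (0 : CC R).
  apply/cvg_cmodP => e e0.
  have e20 : 0 < e / 2 by rewrite divr_gt0.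
  have /cvgrPdist_lt/(_ _ e20) := shift_modulus_cvg0 C Y.
  have tY : (fun t : R => t * Y) @ (0 : R)^'+ --> (0 : R).
    apply: cvg_at_right_filter; rewrite -[X in _ --> X](mul0r Y).
    by apply: cvgM; [exact: cvg_id|exact: cvg_cst].
  have /cvgrPdist_lt/(_ 2^-1) := tY; rewrite invr_gt0 ltr0n => /(_ isT).
  move=> near1 near2; near=> t.
  have t0 : 0 < t by near: t; exact: nbhs_right_gt.
  have tY2 : t * Y <= 2^-1.
    have : `|0 - t * Y| < 2^-1 by near: t.
    by rewrite sub0r normrN ger0_norm; [move/ltW|rewrite mulr_ge0// ltW].
  (* One estimate serves for both the real and the imaginary part, each being allotted [e / 2]. *)
  have le (g : CC R -> R) : continuous g -> (forall z, `|g z| <= cmod z) ->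
      `|Rintegral lambda setT
          (fun x : RN => g (u (t^-1 *: (x : 'rV[R]_N) + y)) * \1_unit_box x) -
        Rintegral lambda setT
          (fun x : RN => g (u (t^-1 *: (x : 'rV[R]_N))) * \1_unit_box x)| < e / 2.
    move=> cg gle; pose G (x : 'rV[R]_N) := g (u (t^-1 *: x)).
    have cG : continuous G.
      move=> x.
      apply: (@continuous_comp 'rV[R]_N (CC R) R (fun x => u (t^-1 *: x)) g);
        last exact: cg.
      apply: (@continuous_comp 'rV[R]_N 'rV[R]_N (CC R) (fun x => t^-1 *: x) u);
        last exact: cu.
      exact: scaler_continuous.
    have := @Rintegral_shift_unit_box_le G C (t * Y) (t *: y)
      (continuous_borel_measurable_real cG).
    have -> : (fun x : RN => G ((x : 'rV[R]_N) + t *: y) * \1_unit_box x) =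
       (fun x : RN => g (u (t^-1 *: (x : 'rV[R]_N) + y)) * \1_unit_box x).
      by apply/funext => x; rewrite /G scalerDr scalerA mulVf ?scale1r ?gt_eqF.
    move=> /(_ _ tY2) h; apply: le_lt_trans (h _ _) _.
    - by move=> x; exact: le_trans (gle _) (uC _).
    - by move=> i; rewrite mxE normrM gtr0_norm// ler_wpM2l// ltW.
    - apply: le_lt_trans (ler_norm _) _; rewrite -normrN -sub0r; near: t; exact: near2.
  rewrite sub0r; apply: le_lt_trans (cmod_le _) _.
  have -> : e = e / 2 + e / 2 by rewrite -splitr.
  have eqRe (v : RN -> CC R) : cRe (cint lambda (fun x => v x * f x)) =
      Rintegral lambda setT (fun x : RN => cRe (v x) * \1_unit_box x).
    rewrite /cint /Rintegral; congr fine; apply: eq_integral => x _.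
    by rewrite -/(cRe _) cReM cRe_ofR cIm_ofR mulr0 subr0.
  have eqIm (v : RN -> CC R) : cIm (cint lambda (fun x => v x * f x)) =
      Rintegral lambda setT (fun x : RN => cIm (v x) * \1_unit_box x).
    rewrite /cint /Rintegral; congr fine; apply: eq_integral => x _.
    by rewrite -/(cIm _) cImM cRe_ofR cIm_ofR mulr0 add0r.
  rewrite cReN cImN !normrN !(cReD, cImD, cReN, cImN) /I /J !eqRe !eqIm.
  apply: ltrD; apply: le.
  - exact: cRe_continuous.
  - exact: normr_cRe_le_cmod.
  - exact: cIm_continuous.
  - exact: normr_cIm_le_cmod.
have : (fun t => J t - I t) @ (0 : R)^'+ --> c' - c by exact: (cvgB cJ cI).
move=> /(cvg_unique CC_hausdorff IJ) /eqP.
by rewrite eq_sym subr_eq0 => /eqP.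
Unshelve. all: by end_near. Qed.

End mean_shift.

(** * Characters *)

Lemma expr_lt_eps (R : realType) (q e : R) : 0 <= q < 1 -> 0 < e ->
  exists k : nat, q ^+ k < e.
Proof.
move=> /andP[q0 q1] e0.
have /cvgr0Pnorm_lt/(_ e e0) : (fun k => q ^+ k) @ \oo --> (0 : R).
  by apply: cvg_expr; rewrite ger0_norm.
move=> [k _ /(_ k (leqnn k))] /=; rewrite ger0_norm ?exprn_ge0// => qe.
by exists k.
Qed.

(** * Real-valued elements of an H-supralgebra and their inverses *)

Section real_part.
Context {R : realType} {N : nat} (A : Hsupralgebra R N).
Local Notation E := ('rV[R]_N).
Implicit Types (f g : E -> R).

(** Real elements are kept as [R]-valued functions so that positivity arguments take place in the
    total order of [R]. *)
Definition realA f := A (fun x => ofR (f x)).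

Lemma eq_A (u v : E -> CC R) : u =1 v -> A u -> A v.
Proof. by move=> /funext ->. Qed.

Lemma A_cst (c : CC R) : A (fun=> c).
Proof. exact: H_const. Qed.

Lemma A_add (u v : E -> CC R) : A u -> A v -> A (fun x => u x + v x).
Proof. exact: H_add. Qed.

Lemma A_scale (c : CC R) (u : E -> CC R) : A u -> A (fun x => c * u x).
Proof. exact: H_scale. Qed.

Lemma A_mul (u v : E -> CC R) : A u -> A v -> A (fun x => u x * v x).
Proof. exact: H_mul. Qed.

Lemma A_sub (u v : E -> CC R) : A u -> A v -> A (fun x => u x - v x).
Proof.
move=> Au Av; apply: eq_A (A_add Au (A_scale (-1) Av)) => x.
by rewrite mulN1r.
Qed.

Lemma realA_cst (r : R) : realA (fun=> r).
Proof. exact: A_cst. Qed.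

Lemma realA_add f g : realA f -> realA g -> realA (fun x => f x + g x).
Proof. by move=> Af Ag; apply: eq_A (A_add Af Ag) => x; rewrite ofRD. Qed.

Lemma realA_mul f g : realA f -> realA g -> realA (fun x => f x * g x).
Proof. by move=> Af Ag; apply: eq_A (A_mul Af Ag) => x; rewrite ofRM. Qed.

Lemma realA_exp f k : realA f -> realA (fun x => f x ^+ k).
Proof.
move=> Af; elim: k => [|k IHk].
  by apply: eq_A (realA_cst 1) => x; rewrite expr0.
by apply: eq_A (realA_mul Af IHk) => x; rewrite exprS.
Qed.

Lemma realA_sum (I : Type) (r : seq I) (F : I -> E -> R) :
  (forall i, realA (F i)) -> realA (fun x => \sum_(i <- r) F i x).
Proof.
move=> AF; elim: r => [|i r IHr].
  by apply: eq_A (realA_cst 0) => x; rewrite big_nil.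
by apply: eq_A (realA_add (AF i) IHr) => x; rewrite big_cons.
Qed.

Lemma realA_cRe u : A u -> realA (fun x => cRe (u x)).
Proof.
move=> Au; apply: eq_A (A_scale (ofR 2^-1) (A_add Au (H_conj Au))) => x.
apply: CC_eq;
  rewrite ?(cReM, cImM, cReD, cImD, cRe_conj, cIm_conj, cRe_ofR, cIm_ofR); lra.
Qed.

Lemma realA_cIm u : A u -> realA (fun x => cIm (u x)).
Proof.
(* The scalar is [1 / (2 i) = - i / 2]. *)
move=> Au; apply: eq_A (A_scale (Complex 0 (- 2^-1)) (A_sub Au (H_conj Au))) => x.
apply: CC_eq; rewrite ?(cReM, cImM, cReD, cImD, cReN, cImN);
  rewrite ?(cRe_conj, cIm_conj, cRe_ofR, cIm_ofR);
  rewrite /cRe /cIm /=; lra.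
Qed.

Lemma realA_continuous f : realA f -> continuous f.
Proof.
move=> /(@H_sub _ _ A)[cf _] x.
exact: (@continuous_comp E (CC R) R (fun x => ofR (f x)) cRe x (cf x)
  (@cRe_continuous R _)).
Qed.

Lemma realA_bounded f : realA f -> exists M, forall x, `|f x| <= M.
Proof.
move=> /(@H_sub _ _ A)[_ [M fM]]; exists M => x.
by rewrite -cmod_ofR.
Qed.

(* Neumann series of [f / M = 1 - (1 - f / M)], where [M] bounds [f] *)
Lemma realA_inv f d : realA f -> 0 < d -> (forall x, d <= f x) ->
  realA (fun x => (f x)^-1).
Proof.
move=> Af d0 df; have [M fM] := realA_bounded Af.
have f0 x : 0 < f x by exact: lt_le_trans (df x).
have fM' x : f x <= M by rewrite (le_trans (ler_norm _)).
have dM : d <= M by exact: le_trans (df 0) (fM' 0).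
have M0 : 0 < M by exact: lt_le_trans dM.
have invd x : `|(f x)^-1| <= d^-1.
  by rewrite gtr0_norm ?invr_gt0// lef_pV2 ?posrE.
apply: (@H_closed _ _ A).
  split.
    move=> x.
    apply: (@continuous_comp E R (CC R) (fun x => (f x)^-1) (@ofR R) x);
      last exact: ofR_continuous.
    by apply: (@cvgV R E (nbhs x) _ f (f x)); [rewrite gt_eqF|exact: realA_continuous].
  by exists d^-1 => x; rewrite cmod_ofR.
move=> e e0; pose q := 1 - d / M.
have q01 : 0 <= q < 1.
  by rewrite /q subr_ge0 ler_pdivrMr// mul1r dM ltrBlDr ltrDl divr_gt0.
(* From [d <= f <= M] one gets [0 <= p <= q < 1] for [p = 1 - f / M]. The remainder after [k] terms
   is [p ^+ k / f], at most [q ^+ k / d], whence the threshold [d * e]. *)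
have [k qk] := expr_lt_eps q01 (mulr_gt0 d0 e0).
pose p x := 1 - f x / M.
have Ap : realA p.
  apply: eq_A (realA_add (realA_cst 1) (realA_mul (realA_cst (- M^-1)) Af)) => x.
  by rewrite /p mulNr mulrC.
exists (fun x => ofR (M^-1 * \sum_(i < k) p x ^+ i)); split.
  apply: (realA_mul (realA_cst M^-1)).
  by apply: realA_sum => i; exact: realA_exp.
move=> x; rewrite -ofRN -ofRD cmod_ofR.
have fx := f0 x.
have p1 : 1 - p x = f x / M by rewrite /p; ring.
have -> : (f x)^-1 - M^-1 * \sum_(i < k) p x ^+ i = (f x)^-1 * p x ^+ k.
  have geom : 1 - p x ^+ k = (f x / M) * \sum_(i < k) p x ^+ i.
    rewrite -p1 -[LHS]opprB subrX1 -mulNr opprB; congr (_ * _).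
  apply: (@mulfI _ (f x)); first by rewrite gt_eqF.
  rewrite mulrBr !mulrA mulfV ?gt_eqF// mul1r -[f x / M * _]geom; ring.
have p0 : 0 <= p x <= q.
  by rewrite /p /q subr_ge0 ler_pdivrMr// mul1r fM' lerD2l lerN2 ler_pM2r ?invr_gt0//=.
have /andP[p0' pq] := p0.
rewrite normrM gtr0_norm ?invr_gt0// ger0_norm ?exprn_ge0//.
rewrite mulrC ltr_pdivrMr//; apply: le_lt_trans (_ : _ <= q ^+ k) _.
  by rewrite lerXn2r ?nnegrE// (le_trans p0').
by apply: lt_le_trans qk _; rewrite mulrC ler_pM2l.
Qed.

End real_part.

(** * Reality, positivity and norm of characters *)

Section characters.
Context {R : realType} {N : nat} (A : Hsupralgebra R N).
Local Notation E := ('rV[R]_N).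
Implicit Types (f g : E -> R) (u v : E -> CC R) (s t : Delta A).
Local Notation G := (gelfand A).

Lemma DeltaP s : is_char A (proj1_sig s).
Proof. by have := proj2_sig s; rewrite inE. Qed.

Lemma gelfand_out u s : ~ A u -> G u s = 0.
Proof. by case: (DeltaP s) => h _; exact: h. Qed.

Lemma gelfandD u v s : A u -> A v -> G (fun x => u x + v x) s = G u s + G v s.
Proof. by case: (DeltaP s) => _ [h _]; exact: h. Qed.

Lemma gelfandZ c u s : A u -> G (fun x => c * u x) s = c * G u s.
Proof. by case: (DeltaP s) => _ [_ [h _]]; exact: h. Qed.

Lemma gelfandM u v s : A u -> A v -> G (fun x => u x * v x) s = G u s * G v s.
Proof. by case: (DeltaP s) => _ [_ [_ [h _]]]; exact: h. Qed.

Lemma gelfand1 s : G (fun=> 1) s = 1.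
Proof.
case: (DeltaP s) => _ [_ [_ [_ [u [Au su]]]]].
apply: (@mulIf _ (G u s)); first exact/eqP.
rewrite -gelfandM ?mul1r//; last exact: A_cst.
by congr G; apply/funext => x; rewrite mul1r.
Qed.

Lemma gelfand_cst c s : G (fun=> c) s = c.
Proof.
have -> : (fun=> c) = (fun x : E => c * 1) by apply/funext => x; rewrite mulr1.
by rewrite (@gelfandZ c (fun=> 1)) ?gelfand1 ?mulr1//; exact: A_cst.
Qed.

Lemma gelfandB u v s : A u -> A v -> G (fun x => u x - v x) s = G u s - G v s.
Proof.
move=> Au Av.
have -> : (fun x => u x - v x) = (fun x => u x + (-1) * v x).
  by apply/funext => x; rewrite mulN1r.
rewrite gelfandD//; last exact: A_scale.
by rewrite gelfandZ// mulN1r.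
Qed.

(** Outside [A] all characters are 0 by the encoding, so their values on [A] determine them. *)
Lemma Delta_eq s t : (forall u, A u -> G u s = G u t) -> s = t.
Proof.
move=> st; apply: val_inj; apply/funext => u; have [Au|nAu] := pselect (A u).
  exact: st.
by transitivity (0 : CC R); [exact: (gelfand_out s nAu)|exact/esym/(gelfand_out t nAu)].
Qed.

(** The inverse of [f] is in [A], so the value at [f] times the value at the inverse is 1. *)
Lemma gelfand_real_neq0 f d s : realA A f -> 0 < d -> (forall x, d <= f x) ->
  G (fun x => ofR (f x)) s != 0.
Proof.
move=> Af d0 df; apply/eqP => sf0; have Ainv := realA_inv Af d0 df.
have := gelfandM s Af Ainv; rewrite sf0 mul0r.
have -> : (fun x => ofR (f x) * ofR (f x)^-1) = (fun=> 1).
  by apply/funext => x; rewrite -ofRM divff ?ofR1// gt_eqF// (lt_le_trans d0).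
by rewrite gelfand1 => /eqP; rewrite oner_eq0.
Qed.

Definition evR f s : R := cRe (G (fun x => ofR (f x)) s).

(* If [s f] had imaginary part [b != 0], then [s] would vanish at the
   invertible element [(f - a)^2 + b^2]. *)
Lemma gelfand_real f s : realA A f -> G (fun x => ofR (f x)) s = ofR (evR f s).
Proof.
move=> Af; set z := G _ s; pose a := cRe z; pose b := cIm z.
apply: CC_eq => //; rewrite cIm_ofR -/b; apply/eqP; apply: contraT => b0.
have Afa : realA A (fun x => f x - a) := realA_add Af (realA_cst A (- a)).
have Aw := realA_add (realA_mul Afa Afa) (realA_cst A (b ^+ 2)).
have b20 : 0 < b ^+ 2 by rewrite exprn_even_gt0.
have bw x : b ^+ 2 <= (f x - a) * (f x - a) + b ^+ 2.
  by rewrite lerDr -expr2 sqr_ge0.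
have /negP[] := gelfand_real_neq0 s Aw b20 bw.
have -> : (fun x => ofR ((f x - a) * (f x - a) + b ^+ 2)) =
    (fun x => (ofR (f x) + ofR (- a)) * (ofR (f x) + ofR (- a)) + ofR (b ^+ 2)).
  by apply/funext => x; rewrite ofRD ofRM ofRD.
have A1 : A (fun x => ofR (f x) + ofR (- a)) by apply: A_add => //; exact: A_cst.
rewrite gelfandD; [|exact: A_mul|exact: A_cst].
rewrite gelfandM// gelfandD//; last exact: A_cst.
rewrite !gelfand_cst -/z; apply/eqP; apply: CC_eq;
  rewrite ?(cReD, cImD, cReM, cImM, cRe_ofR, cIm_ofR) -/a -/b; ring.
Qed.

Lemma evR_cst r s : evR (fun=> r) s = r.
Proof. by rewrite /evR gelfand_cst. Qed.

Lemma evRD f g s : realA A f -> realA A g ->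
  evR (fun x => f x + g x) s = evR f s + evR g s.
Proof.
move=> Af Ag; rewrite /evR -cReD -gelfandD//; congr (cRe (G _ s)).
by apply/funext => x; rewrite ofRD.
Qed.

Lemma evRM f g s : realA A f -> realA A g ->
  evR (fun x => f x * g x) s = evR f s * evR g s.
Proof.
move=> Af Ag; apply: ofR_inj; rewrite ofRM -!gelfand_real//; last exact: realA_mul.
by rewrite -gelfandM//; congr (G _ s); apply/funext => x; rewrite ofRM.
Qed.

Lemma evRX f k s : realA A f -> evR (fun x => f x ^+ k) s = evR f s ^+ k.
Proof.
move=> Af; elim: k => [|k IHk].
  have -> : (fun x => f x ^+ 0) = (fun=> 1) by [].
  by rewrite evR_cst expr0.
have -> : (fun x => f x ^+ k.+1) = (fun x => f x * f x ^+ k).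
  by apply/funext => x; rewrite exprS.
by rewrite evRM ?IHk ?exprS//; exact: realA_exp.
Qed.

Lemma evR_sum (I : Type) (r : seq I) (F : I -> E -> R) s :
  (forall i, realA A (F i)) ->
  evR (fun x => \sum_(i <- r) F i x) s = \sum_(i <- r) evR (F i) s.
Proof.
move=> AF; elim: r => [|i r IHr].
  rewrite big_nil -[RHS](evR_cst 0 s); congr evR; apply/funext => x.
  by rewrite big_nil.
rewrite big_cons -IHr -evRD//; last exact: realA_sum.
by congr evR; apply/funext => x; rewrite big_cons.
Qed.

(** If the value were negative, [f - evR f s] would be bounded below by the positive constant
    [- evR f s], yet the character vanishes on it. *)
Lemma evR_ge0 f s : realA A f -> (forall x, 0 <= f x) -> 0 <= evR f s.
Proof.
move=> Af f0; rewrite leNgt; apply/negP => sf.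
have Ag := realA_add Af (realA_cst A (- evR f s)).
have Ngt0 : 0 < - evR f s by rewrite oppr_gt0.
have gN x : - evR f s <= f x - evR f s by rewrite lerDr.
have /negP[] := gelfand_real_neq0 s Ag Ngt0 gN.
rewrite gelfand_real// evRD//; last exact: realA_cst.
by rewrite evR_cst subrr.
Qed.

Lemma evR_le f g s : realA A f -> realA A g -> (forall x, f x <= g x) ->
  evR f s <= evR g s.
Proof.
move=> Af Ag fg; have AN := realA_mul (realA_cst A (-1)) Af.
have : 0 <= evR (fun x => g x + -1 * f x) s.
  apply: evR_ge0; first exact: realA_add.
  by move=> x; rewrite mulN1r subr_ge0.
rewrite evRD// evRM//; last exact: realA_cst.
by rewrite evR_cst mulN1r subr_ge0.
Qed.

Lemma evR_inv f d s : realA A f -> 0 < d -> (forall x, d <= f x) ->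
  evR (fun x => (f x)^-1) s = (evR f s)^-1.
Proof.
move=> Af d0 df; have Ainv := realA_inv Af d0 df.
have sf0 : evR f s != 0.
  have := gelfand_real_neq0 s Af d0 df; rewrite gelfand_real//.
  by apply: contraNneq => ->.
apply: (mulfI sf0); rewrite divff// -evRM// -[RHS](evR_cst 1 s).
congr evR; apply/funext => x.
by rewrite divff// gt_eqF// (lt_le_trans d0).
Qed.

Lemma gelfandE u s : A u ->
  G u s = Complex (evR (fun x => cRe (u x)) s) (evR (fun x => cIm (u x)) s).
Proof.
move=> Au; have ARe := realA_cRe Au; have AIm := realA_cIm Au.
have -> : G u s = G (fun x => ofR (cRe (u x)) + Complex 0 1 * ofR (cIm (u x))) s.
  congr (G _ s); apply/funext => x.
  by apply: CC_eq; rewrite ?(cReD, cImD, cReM, cImM, cRe_ofR, cIm_ofR) /cRe /cIm /=; ring.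
rewrite gelfandD//; last exact: A_scale.
rewrite gelfandZ// !gelfand_real//.
by apply: CC_eq; rewrite ?(cReD, cImD, cReM, cImM, cRe_ofR, cIm_ofR) /cRe /cIm /=; ring.
Qed.

Lemma realA_sqr_cmod u : A u -> realA A (fun x => cmod (u x) ^+ 2).
Proof.
move=> Au; have -> : (fun x => cmod (u x) ^+ 2) =
    (fun x => cRe (u x) ^+ 2 + cIm (u x) ^+ 2).
  by apply/funext => x; rewrite sqr_cmod.
by apply: realA_add; apply: realA_exp; [exact: realA_cRe|exact: realA_cIm].
Qed.

Lemma evR_sqr_cmod u s : A u -> evR (fun x => cmod (u x) ^+ 2) s = cmod (G u s) ^+ 2.
Proof.
move=> Au; have -> : (fun x => cmod (u x) ^+ 2) =
    (fun x => cRe (u x) ^+ 2 + cIm (u x) ^+ 2).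
  by apply/funext => x; rewrite sqr_cmod.
have ARe := realA_cRe Au; have AIm := realA_cIm Au.
by rewrite evRD ?evRX//; [rewrite sqr_cmod gelfandE|exact: realA_exp|exact: realA_exp].
Qed.

(** The squared modulus is a polynomial in the real and imaginary parts, so evaluation commutes with
    it; monotonicity of [evR] then compares it with [C ^+ 2]. No square root has to be taken inside
    [A]. *)
Lemma cmod_gelfand_le u (C : R) s : A u -> (forall x, cmod (u x) <= C) ->
  cmod (G u s) <= C.
Proof.
move=> Au uC; have C0 : 0 <= C by exact: le_trans (cmod_ge0 _) (uC 0).
rewrite -(@ler_pXn2r _ 2) ?nnegrE ?cmod_ge0// -evR_sqr_cmod// -[leRHS](evR_cst _ s).
apply: evR_le; [exact: realA_sqr_cmod|exact: realA_cst|].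
by move=> x; rewrite ler_pXn2r ?nnegrE ?cmod_ge0.
Qed.

End characters.

(** * Topology of the spectrum *)

Lemma ptws_cvgP (U : Type) (V : topologicalType)
    (F : set_system {ptws U -> V}) (f : {ptws U -> V}) : Filter F ->
  F --> f <-> forall t, (fun g : {ptws U -> V} => g t) @ F --> f t.
Proof.
move=> FF; split=> [/cvg_sup Ff t W nW|Ff].
  exact: Ff t _ (@initial_continuous _ V (fun g : {ptws U -> V} => g t) f W nW).
apply/cvg_sup => t W [_ [[B Bop <-] Bf]] /filterS; apply.
by apply: (Ff t); exact: open_nbhs_nbhs.
Qed.

Section spectrum_topology.
Context {R : realType} {N : nat} (A : Hsupralgebra R N).
Local Notation E := ('rV[R]_N).
Implicit Types (f g : E -> R) (u v : E -> CC R) (s t : Delta A).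
Local Notation G := (gelfand A).

(** The topology is that of pointwise convergence on all functions, but off [A] the evaluations are
    constantly 0, so only elements of [A] need testing. *)
Lemma cvg_DeltaP (F : set_system (Delta A)) s : Filter F ->
  (forall u, A u -> G u @ F --> G u s) -> F --> s.
Proof.
move=> FF Fs V /= [_ [[B Bop <-] Bs BV]].
have cvF : (set_val @ F : set_system {ptws (E -> CC R) -> CC R}) --> \val s.
  apply/ptws_cvgP => u; have [Au|nAu] := pselect (A u); first exact: Fs.
  have -> : (\val s) u = 0 by exact: (gelfand_out s nAu).
  have G0 : G u = fun=> 0 by apply/funext => t; exact: gelfand_out.
  have : G u @ F --> (0 : CC R) by rewrite G0; exact: cvg_cst.
  exact.
have /cvF : nbhs (\val s : {ptws (E -> CC R) -> CC R}) B by rewrite nbhsE; exists B.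
by move=> FB; exact: (filterS BV FB).
Qed.

Lemma gelfand_continuous u : continuous (G u).
Proof.
move=> s.
have cs : (set_val @ nbhs s : set_system {ptws (E -> CC R) -> CC R}) --> \val s.
  exact: (@initial_continuous _ _ (set_val : Delta A -> {ptws (E -> CC R) -> CC R}) s).
by have /ptws_cvgP/(_ u) := cs; exact.
Qed.

Lemma Delta_hausdorff : hausdorff_space (Delta A).
Proof.
move=> s t st; apply: Delta_eq => u _; apply: CC_hausdorff => V W nV nW.
have := st _ _ (@gelfand_continuous u s _ nV) (@gelfand_continuous u t _ nW).
by move=> [x [Vx Wx]]; exists (G u x).
Qed.

Lemma evR_continuous f : continuous (@evR R N A f).
Proof.
move=> s; apply: (@continuous_comp (Delta A) (CC R) R (G (fun x => ofR (f x))) cRe s).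
  exact: gelfand_continuous.
exact: cRe_continuous.
Qed.

(** The sets [evR f < 2], for [f >= 0] with [evR f s = 0], form a filter base, since the set of a
    sum lies in both sets of its terms. This filter converges to [s], so a single [f] replaces a
    finite intersection of subbasic neighbourhoods. *)
Lemma nbhs_Delta_evR s (V : set (Delta A)) : nbhs s V ->
  exists f, [/\ realA A f, forall x, 0 <= f x, evR f s = 0 &
    [set t : Delta A | evR f t < 2] `<=` V].
Proof.
pose D := [set f | [/\ realA A f, forall x, 0 <= f x & evR f s = 0]].
pose B f := [set t : Delta A | evR f t < 2].
have FF : Filter (filter_from D B).
  apply: filter_from_filter.
    by exists (fun=> 0); split => //; [exact: realA_cst|exact: evR_cst].
  move=> f g [Af f0 sf] [Ag g0 sg]; exists (fun x => f x + g x).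
    by split; [exact: realA_add|move=> x; exact: addr_ge0|rewrite evRD// sf sg addr0].
  move=> t; rewrite /B /= evRD// => fg.
  have ft : 0 <= evR f t by exact: evR_ge0.
  have gt : 0 <= evR g t by exact: evR_ge0.
  by split; apply: le_lt_trans fg; rewrite ?lerDl ?lerDr.
suff : filter_from D B --> s.
  by move=> h /h [f [Af f0 sf] fV]; exists f; split.
apply: cvg_DeltaP => u Au; apply/cvg_cmodP => e e0.
have Av : A (fun x => u x - G u s) by apply: A_sub => //; exact: A_cst.
have Av2 := realA_sqr_cmod Av.
have e2 : 0 < 2 / e ^+ 2 by rewrite divr_gt0// exprn_gt0.
(* Scaled so that being below 2 at [t] means that [G u t] is within [e] of [G u s]. *)
exists (fun x => 2 / e ^+ 2 * cmod (u x - G u s) ^+ 2).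
  split.
  - by apply: realA_mul => //; exact: realA_cst.
  - by move=> x; rewrite mulr_ge0 ?sqr_ge0// ltW.
  - rewrite evRM//; last exact: realA_cst.
    rewrite evR_sqr_cmod// gelfandB//; last exact: A_cst.
    by rewrite gelfand_cst subrr -/(@ofR R 0) cmod_ofR normr0 expr0n mulr0.
move=> t; rewrite /B /= evRM//; last exact: realA_cst.
rewrite evR_cst evR_sqr_cmod// gelfandB//; last exact: A_cst.
rewrite gelfand_cst cmodB_sym mulrAC ltr_pdivrMr ?exprn_gt0// ltr_pM2l//.
by rewrite ltr_pXn2r// ?nnegrE ?cmod_ge0// ltW.
Qed.

(* With [f_1, .., f_k] in [A] such that the sets [f_i < 1/2] cover [K] while
   [f_i >= 2] off [U], the function [w / (1 + w)], [w = sum_i (1/4 + f_i)^-n],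
   is close to 1 on [K] and to 0 off [U] for large [n]. *)
Lemma realA_urysohn (K U : set (Delta A)) (e : R) :
  compact K -> open U -> K `<=` U -> 0 < e ->
  exists f, [/\ realA A f, forall x, 0 <= f x <= 1,
    forall t, K t -> 1 - e <= evR f t & forall t, ~ U t -> evR f t <= e].
Proof.
move=> cK oU KU e0.
have [F PF] : {F : Delta A -> E -> R & forall s, K s ->
    [/\ realA A (F s), forall x, 0 <= F s x, evR (F s) s = 0 &
    [set t : Delta A | evR (F s) t < 2] `<=` U]}.
  apply: (@choice _ _ (fun s f => K s -> [/\ realA A f, forall x, 0 <= f x,
    evR f s = 0 & [set t : Delta A | evR f t < 2] `<=` U])) => s.
  have [Ks|nKs] := pselect (K s); last by exists (fun=> 0).
  have [f Pf] := @nbhs_Delta_evR s U (open_nbhs_nbhs (conj oU (KU _ Ks))).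
  by exists f.
pose V s := [set t : Delta A | evR (F s) t < 2^-1].
have oV s : open (V s).
  have -> : V s = evR (F s) @^-1` `]-oo, 2^-1[.
    by apply/seteqP; split => t /=; rewrite /V /= in_itv.
  by move/continuousP : (@evR_continuous (F s)); apply; exact: interval_open.
move: cK; rewrite compact_cover => /(_ (Delta A) K V (fun s _ => oV s)).
case=> [s Ks|D DK KD].
  by exists s => //; have [_ _ s0 _] := PF s Ks; rewrite /V /= s0 invr_gt0.
pose r := [seq s <- finmap.enum_fset D | `[< K s >]].
have rK s : s \in r -> K s by rewrite mem_filter => /andP[/asboolP].
(* [PF] says nothing about [F s] outside [K]; the default 0 puts every index in [realA], as
   [realA_sum] requires. *)
pose F' s := if `[< K s >] then F s else fun=> 0.
have F'E s : K s -> F' s = F s by move=> Ks; rewrite /F' asboolT.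
have AF s : realA A (F' s).
  by rewrite /F'; case: asboolP => [/PF[]//|_]; exact: realA_cst.
have F0 s x : 0 <= F' s x.
  by rewrite /F'; case: asboolP => [/PF[]//|_].
pose h s x := (4^-1 + F' s x)^-1.
have q0 : 0 < 4^-1 :> R by rewrite invr_gt0.
have Aq s : realA A (fun x => 4^-1 + F' s x) by apply: realA_add => //; exact: realA_cst.
have Fq s x : 4^-1 <= 4^-1 + F' s x by rewrite lerDl.
have Ah s : realA A (h s) := realA_inv (Aq s) q0 (Fq s).
have hE s t : evR (h s) t = (4^-1 + evR (F' s) t)^-1.
  rewrite /h (evR_inv t (Aq s) q0 (Fq s)) evRD//; last exact: realA_cst.
  by rewrite evR_cst.
have h0 s x : 0 <= h s x by rewrite invr_ge0 addr_ge0// ltW.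
(* On [V s] the function [h s] is at least [1 / (1/4 + 1/2) = 4/3], and off [U] it is at most
   [1 / (1/4 + 2)], hence at most 3/4. So [1 / (1 + w)] on [K] is at most [(3 / 4) ^+ n], and [w]
   off [U] at most [size r] times that. The successor of [size r] keeps the divisor positive. *)
have [n qn] : exists n : nat, (3 / 4) ^+ n < e / (size r).+1%:R.
  by apply: expr_lt_eps; [lra|rewrite divr_gt0].
pose w x := \sum_(s <- r) h s x ^+ n.
have Aw : realA A w by apply: realA_sum => s; exact: realA_exp.
have w0 x : 0 <= w x by apply: sumr_ge0 => s _; exact: exprn_ge0.
have wE t : evR w t = \sum_(s <- r) evR (h s) t ^+ n.
  rewrite /w evR_sum => [|s]; last exact: realA_exp.
  by apply: eq_bigr => s _; rewrite evRX.
have A1w : realA A (fun x => 1 + w x) by apply: realA_add => //; exact: realA_cst.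
have w1 x : 1 <= 1 + w x by rewrite lerDl.
have Ainv := realA_inv A1w ltr01 w1.
have evw0 t : 0 <= evR w t by exact: evR_ge0.
have invE t : evR (fun x => (1 + w x)^-1) t = (1 + evR w t)^-1.
  rewrite (evR_inv t A1w ltr01 w1) evRD//; last exact: realA_cst.
  by rewrite evR_cst.
have AN := realA_mul (realA_cst A (-1)) Ainv.
exists (fun x => 1 + -1 * (1 + w x)^-1).
have evE t : evR (fun x => 1 + -1 * (1 + w x)^-1) t = 1 - (1 + evR w t)^-1.
  rewrite evRD//; last exact: realA_cst.
  rewrite evRM//; last exact: realA_cst.
  by rewrite !evR_cst invE mulN1r.
have r1 : 1 <= (size r).+1%:R :> R by rewrite ler1n.
have r0 : 0 < (size r).+1%:R :> R by rewrite ltr0n.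
split.
- by apply: realA_add => //; exact: realA_cst.
- move=> x; rewrite mulN1r subr_ge0 invf_le1 ?(lt_le_trans ltr01)// w1 /=.
  by rewrite gerBl invr_ge0 (le_trans ler01).
- move=> t Kt; rewrite evE lerD2l lerN2.
  have [s sD ts] := KD t Kt.
  have Ks : K s by apply: set_mem; exact: DK.
  have sr : s \in r by rewrite mem_filter asboolT.
  have ht : 4 / 3 <= evR (h s) t.
    rewrite hE F'E// -[4 / 3]invrK lef_pV2 ?posrE ?invr_gt0//; last first.
      by rewrite ltr_pwDl// -F'E// evR_ge0.
    by move: ts; rewrite /V /=; lra.
  have wt : (4 / 3) ^+ n <= evR w t.
    rewrite wE (big_rem s)//= -[leLHS]addr0; apply: lerD.
      by rewrite lerXn2r ?nnegrE//; lra.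
    by apply: sumr_ge0 => s' _; rewrite exprn_ge0// evR_ge0.
  have q43 : 0 < (4 / 3 : R) ^+ n by rewrite exprn_gt0.
  apply: (@le_trans _ _ ((4 / 3) ^+ n)^-1).
    by rewrite lef_pV2 ?posrE ?ltr_pwDl//; lra.
  rewrite -exprVn invf_div; apply: le_trans (ltW qn) _.
  by rewrite ler_pdivrMr// ler_peMr// ltW.
- move=> t nUt; rewrite evE.
  have w1t : 0 < 1 + evR w t by rewrite ltr_pwDl.
  apply: (@le_trans _ _ (evR w t)).
    rewrite lerBlDr -subr_ge0.
    have -> : evR w t + (1 + evR w t)^-1 - 1 = evR w t ^+ 2 / (1 + evR w t).
      by field; rewrite gt_eqF.
    by rewrite divr_ge0// ?sqr_ge0// ltW.
  rewrite wE; apply: (@le_trans _ _ (\sum_(s <- r) (3 / 4) ^+ n)).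
    rewrite big_seq [leRHS]big_seq; apply: ler_sum => s sr.
    have Ks := rK s sr; have [_ _ _ sU] := PF s Ks.
    have Ft : 2 <= evR (F s) t.
      by rewrite leNgt; apply/negP => tF; exact/nUt/sU.
    have h34 : evR (h s) t <= 3 / 4.
      by rewrite hE F'E// -[3 / 4]invrK lef_pV2 ?posrE ?invr_gt0//; lra.
    by rewrite lerXn2r ?nnegrE ?evR_ge0//; lra.
  rewrite big_const_seq count_predT iter_addr_0 -[leLHS]mulr_natl.
  apply: (@le_trans _ _ ((size r).+1%:R * (3 / 4) ^+ n)).
    by rewrite ler_wpM2r ?exprn_ge0 ?ler_nat//; lra.
  by move: (ltW qn); rewrite ler_pdivlMr// mulrC.
Qed.

End spectrum_topology.

(** * The translation flow *)

Section translation_flow.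
Context {R : realType} {N : nat} (A : Hsupralgebra R N).
Local Notation E := ('rV[R]_N).
Implicit Types (f g : E -> R) (u v : E -> CC R) (s t : Delta A) (y : E).
Local Notation G := (gelfand A).
Hypothesis A_transl : forall u y, A u -> A (fun x => u (x + y)).

(** Extended by 0 outside [A], as the encoding of characters demands. *)
Definition shift_fun y s : (E -> CC R) -> CC R :=
  fun u => if `[< A u >] then G (fun x => u (x + y)) s else 0.

Lemma shift_fun_char y s : shift_fun y s \in @is_char R N A.
Proof.
rewrite inE /shift_fun; split; [|split; [|split; [|split]]].
- by move=> u /asboolPn/negbTE ->.
- move=> u v Au Av; rewrite !asboolT//; last exact: A_add.
  by rewrite -gelfandD//; exact: A_transl.
- move=> c u Au; rewrite !asboolT//; last exact: A_scale.
  by rewrite -gelfandZ//; exact: A_transl.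
- move=> u v Au Av; rewrite !asboolT//; last exact: A_mul.
  by rewrite -gelfandM//; exact: A_transl.
- exists (fun=> 1); have A1 := A_cst A 1; split => //.
  by rewrite asboolT// gelfand1; apply/eqP; exact: oner_neq0.
Qed.

Definition shift_Delta y s : Delta A := exist _ (shift_fun y s) (shift_fun_char y s).

Lemma gelfand_shift y u s : A u -> G (fun x => u (x + y)) s = G u (shift_Delta y s).
Proof. by move=> Au; rewrite {2}/gelfand /shift_Delta /= /shift_fun asboolT. Qed.

Lemma shift_Delta0 : shift_Delta 0 = id.
Proof.
apply/funext => s; apply: Delta_eq => u Au; rewrite -gelfand_shift//.
by congr (G _ s); apply/funext => x; rewrite addr0.
Qed.

Lemma shift_DeltaD x y : shift_Delta (x + y) = shift_Delta x \o shift_Delta y.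
Proof.
apply/funext => s; apply: Delta_eq => u Au.
rewrite /comp -gelfand_shift// -gelfand_shift//.
rewrite -gelfand_shift; last exact: A_transl.
by congr (G _ s); apply/funext => z; rewrite addrAC addrA.
Qed.

Lemma shift_DeltaK y : cancel (shift_Delta y) (shift_Delta (- y)).
Proof.
move=> s; have := congr1 (@^~ s) (shift_DeltaD (- y) y).
by rewrite addNr shift_Delta0 /= => <-.
Qed.

Lemma shift_DeltaNK y : cancel (shift_Delta (- y)) (shift_Delta y).
Proof. by move=> s; rewrite -{1}[y]opprK shift_DeltaK. Qed.

(** Invariance is stated for images, whereas measurability and openness pass to preimages under
    continuous maps. *)
Lemma image_shift_Delta y (F : set (Delta A)) :
  shift_Delta y @` F = shift_Delta (- y) @^-1` F.
Proof.
apply/seteqP; split => [_ [s Fs <-]|s Fs]; first by rewrite /= shift_DeltaK.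
by exists (shift_Delta (- y) s) => //; rewrite shift_DeltaNK.
Qed.

Lemma shift_Delta_unique (T : E -> Delta A -> Delta A) :
  (forall y u s, A u -> G (fun x => u (x + y)) s = G u (T y s)) ->
  T = shift_Delta.
Proof.
move=> hT; apply/funext => y; apply/funext => s; apply: Delta_eq => u Au.
by rewrite -hT// gelfand_shift.
Qed.

Lemma shift_Delta_continuous y : continuous (shift_Delta y).
Proof.
move=> s; have FF : Filter (shift_Delta y @ s).
  exact: (@fmap_filter _ _ (shift_Delta y) (nbhs s) _).
apply: cvg_DeltaP => u Au.
have -> : G u (shift_Delta y s) = G (fun x => u (x + y)) s by rewrite gelfand_shift.
have : G (fun x => u (x + y)) t @[t --> s] --> G (fun x => u (x + y)) s.
  exact: gelfand_continuous.
rewrite (_ : G (fun x => u (x + y)) = G u \o shift_Delta y)//.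
by apply/funext => t /=; rewrite gelfand_shift.
Qed.

Lemma shift_Delta_homeo y : homeo (shift_Delta y).
Proof.
split; first exact: shift_Delta_continuous.
exists (shift_Delta (- y)); split; first exact: shift_Delta_continuous.
by split; [exact: shift_DeltaK|exact: shift_DeltaNK].
Qed.

(** Uniform continuity makes translation continuous for the sup norm; this is its role in the joint
    continuity of the flow. *)
Lemma unif_continuous_near u y (e : R) : unif_continuous u -> 0 < e ->
  \forall z \near y, forall x, cmod (u (x + y) - u (x + z)) < e.
Proof.
move=> uc e0.
have e0' : 0 < ofR e by rewrite ltcE /= e0 eqxx.
have entE : entourage [set p : CC R * CC R | ball p.1 (ofR e) p.2].
  by rewrite -entourage_ballE; exists (ofR e).
have /= := uc _ entE; rewrite nbhs_simpl -entourage_ballE => -[d /= d0 dE].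
apply: filterS (nbhsx_ballx y d d0) => z [_ yz] x.
have xyz : ball (x + y) d (x + z).
  by split => // i j; have := yz i j; rewrite /ball /= !mxE opprD addrACA subrr add0r.
by have := dE (x + y, x + z) xyz; rewrite /ball /= norm_cmod ltcE /= => /andP[].
Qed.

Hypothesis A_uc : forall u, A u -> unif_continuous u.

Lemma shift_Delta_dynamical : dynamical_system shift_Delta.
Proof.
split; first exact: shift_Delta0.
split; first exact: shift_DeltaD.
move=> [y s].
have FF : Filter ((fun p : E * Delta A => shift_Delta p.1 p.2) @ (y, s)).
  exact: fmap_filter.
apply: cvg_DeltaP => u Au; apply/cvg_cmodP => e e0.
have e20 : 0 < e / 2 by rewrite divr_gt0.
have Auy : A (fun x => u (x + y)) by exact: A_transl.
have near1 := unif_continuous_near y (A_uc Au) e20.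
have near2 : \forall t \near s,
    cmod (G (fun x => u (x + y)) s - G (fun x => u (x + y)) t) < e / 2.
  have : G (fun x => u (x + y)) t @[t --> s] --> G (fun x => u (x + y)) s.
    exact: gelfand_continuous.
  by move=> /(@cvg_cmodP _ _ (nbhs s))/(_ _ e20).
exists ([set z | forall x, cmod (u (x + y) - u (x + z)) < e / 2],
  [set t | cmod (G (fun x => u (x + y)) s - G (fun x => u (x + y)) t) < e / 2]) => //.
move=> [z t] [/= yz st].
change (cmod (G u (shift_Delta y s) - G u (shift_Delta z t)) < e).
rewrite -!gelfand_shift//.
have Auz : A (fun x => u (x + z)) by exact: A_transl.
(* The intermediate value is that of [u (. + y)] at [t]. Continuity of its Gelfand transform at [s]
   controls one difference; the norm bound controls the other uniformly in [t]. *)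
rewrite -[X in cmod X](subrKA (G (fun x => u (x + y)) t)) [e]splitr.
apply: le_lt_trans (ler_cmodD _ _) _; apply: ltr_leD => //.
rewrite -gelfandB//; apply: cmod_gelfand_le; first exact: A_sub.
by move=> x; exact/ltW/yz.
Qed.

End translation_flow.

(** * Invariance of the M-measure *)

Section probability_Rintegral.
Context d (T : measurableType d) {R : realType} (P : probability T R).

Lemma probability_integrable_bounded (g : T -> R) (C : R) :
  measurable_fun setT g -> (forall x, `|g x| <= C) ->
  P.-integrable setT (EFin \o g).
Proof.
move=> mg gC; apply: (@le_integrable _ _ _ P _ _ _ (EFin \o cst C)) => //.
- exact/measurable_EFinP.
- by move=> x _; rewrite /= lee_fin (le_trans (gC x))// ler_norm.
- exact: finite_measure_integrable_cst.
Qed.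

Lemma probability_Rintegral_cst (r : R) : Rintegral P setT (fun=> r) = r.
Proof.
have P1 : fine (P setT) = 1 by rewrite probability_setT.
by rewrite Rintegral_cst// P1 mulr1.
Qed.

Lemma Rintegral_indicT (X : set T) : measurable X ->
  Rintegral P setT (\1_X : T -> R) = fine (P X).
Proof. by move=> mX; rewrite /Rintegral integral_indic// setIT. Qed.

End probability_Rintegral.

Section invariance.
Context {R : realType} {n : nat} (A : Hsupralgebra R n.+1).
Local Notation E := ('rV[R]_n.+1).
Hypothesis A_transl : forall (u : E -> CC R) (y : E), A u -> A (fun x => u (x + y)).
Variables (b : probability (BDelta A) R) (Mb : M_measure b).
Local Notation T := (shift_Delta A_transl).
Local Notation G := (gelfand A).

(** The two sides are the real parts of the mean values of [f (. + y)] and of [f], which agree by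
    [mean_value_shift]. *)
Lemma Rintegral_evR_shift (y : E) (f : E -> R) : realA A f ->
  Rintegral b setT (fun t : BDelta A => evR f (T y t)) =
  Rintegral b setT (fun t : BDelta A => evR f t).
Proof.
move=> Af; have [_ mean] := Mb.
have /(congr1 (@cRe R)) eqRe :=
  mean_value_shift (H_sub Af) (mean _ Af) (mean _ (A_transl y Af)).
transitivity (cRe (cint b (G (fun x => ofR (f (x + y)))))); last by rewrite -eqRe.
rewrite /Rintegral /cint /cRe /=; congr fine; apply: eq_integral => t _.
by rewrite /evR -(gelfand_shift A_transl).
Qed.

Lemma measurable_evR (f : E -> R) :
  measurable_fun setT (fun t : BDelta A => evR f t).
Proof.
exact: (@continuous_borel_measurable_real (Delta A) R _ (@evR_continuous _ _ A f)).
Qed.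

Lemma measurable_shift_Delta (y : E) :
  measurable_fun setT (fun t : BDelta A => T y t : BDelta A).
Proof.
exact: (@continuous_borel_measurable (Delta A) (Delta A) _
  (@shift_Delta_continuous _ _ A A_transl y)).
Qed.

Lemma measurable_open_Delta (U : set (BDelta A)) : @open (Delta A) U -> measurable U.
Proof. by move=> oU; apply: sub_sigma_algebra. Qed.

Lemma compact_le_preimage_shift (y : E) (K U : set (BDelta A)) :
  @compact (Delta A) K -> @open (Delta A) U -> K `<=` U ->
  (b K <= b (T y @^-1` U))%E.
Proof.
move=> cK oU KU.
have mK : measurable K.
  rewrite -[K]setCK; apply: measurableC; apply: measurable_open_Delta.
  apply: closed_openC; apply: compact_closed => //; exact: Delta_hausdorff.
have mU : measurable U by exact: measurable_open_Delta.
have mTU : measurable (T y @^-1` U : set (BDelta A)).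
  by rewrite -[X in measurable X]setTI; exact: measurable_shift_Delta.
rewrite -[b K]fineK ?fin_num_measure// -[leRHS]fineK ?fin_num_measure// lee_fin.
apply/ler_addgt0Pr => e e0; have e20 : 0 < e / 2 by rewrite divr_gt0.
have [f [Af f01 fK fU]] := realA_urysohn cK oU KU e20.
have f0 (t : Delta A) : 0 <= evR f t by apply: evR_ge0 => // x; have /andP[] := f01 x.
have f1 (t : Delta A) : evR f t <= 1.
  rewrite -[leRHS](evR_cst 1 t); apply: evR_le => //; first exact: realA_cst.
  by move=> x; have /andP[] := f01 x.
have fn (t : Delta A) : `|evR f t| <= 1 by rewrite ger0_norm.
have if0 := probability_integrable_bounded b (measurable_evR f) fn.
have mfT : measurable_fun setT (fun t : BDelta A => evR f (T y t)).
  exact: (measurableT_comp (measurable_evR f) (measurable_shift_Delta y)).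
have ifT := probability_integrable_bounded b mfT (fun t => fn (T y t)).
have ind1 (X : set (BDelta A)) t : `|\1_X t : R| <= 1.
  by rewrite indicE; case: (_ \in _); rewrite ?normr1 ?normr0.
have iK := probability_integrable_bounded b (@measurable_indic _ _ R _ _ mK) (ind1 K).
have iTU := probability_integrable_bounded b (@measurable_indic _ _ R _ _ mTU) (ind1 _).
have ie : b.-integrable setT (EFin \o cst (e / 2)).
  exact: finite_measure_integrable_cst.
have leK : fine (b K) - e / 2 <= Rintegral b setT (fun t : BDelta A => evR f t).
  rewrite -(probability_Rintegral_cst b (e / 2)) -Rintegral_indicT// -RintegralB//.
  apply: le_Rintegral => //; first exact: (integrableB measurableT iK ie).
  move=> t _; rewrite ?indicE; case: (boolP (t \in K)) => [/set_mem/fK|_] /=.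
    lra.
  by have := f0 t; lra.
have leU : Rintegral b setT (fun t : BDelta A => evR f (T y t)) <=
    fine (b (T y @^-1` U)) + e / 2.
  rewrite -(probability_Rintegral_cst b (e / 2)) -Rintegral_indicT// -RintegralD//.
  apply: le_Rintegral => //; first exact: (integrableD measurableT iTU ie).
  move=> t _; rewrite ?indicE; case: (boolP (t \in T y @^-1` U)) => [_|/negP tU] /=.
    by have := f1 (T y t); lra.
  have /fU : ~ U (T y t) by move=> Ut; apply: tU; exact: mem_set.
  lra.
rewrite [e]splitr addrA -lerBlDr; apply: le_trans leK _.
by rewrite -(Rintegral_evR_shift y Af).
Qed.

Lemma open_le_preimage_shift (y : E) (U : set (BDelta A)) :
  @open (Delta A) U -> (b U <= b (T y @^-1` U))%E.
Proof.
move=> oU; have [radb _] := Mb.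
have [_ ->] := radb U (measurable_open_Delta oU).
by apply: ge_ereal_sup => _ [K [cK KU] <-]; exact: compact_le_preimage_shift.
Qed.

Lemma open_preimage_shift (y : E) (U : set (BDelta A)) :
  @open (Delta A) U -> @open (Delta A) (T y @^-1` U).
Proof.
by move=> oU; move/continuousP : (@shift_Delta_continuous _ _ A A_transl y); exact.
Qed.

Lemma preimage_shiftK (y : E) (F : set (BDelta A)) :
  T (- y) @^-1` (T y @^-1` F) = F.
Proof. by apply/seteqP; split => s /=; rewrite shift_DeltaNK. Qed.

Lemma preimage_shift_le (y : E) (F : set (BDelta A)) : measurable F ->
  (b (T y @^-1` F) <= b F)%E.
Proof.
move=> mF; have [radb _] := Mb; have [-> _] := radb F mF.
apply: le_ereal_inf_tmp => _ [U [oU FU] <-].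
have mT (X : set (BDelta A)) : measurable X -> measurable (T y @^-1` X : set (BDelta A)).
  by move=> mX; rewrite -[X in measurable X]setTI; exact: measurable_shift_Delta.
apply: (@le_trans _ _ (b (T y @^-1` U))).
  apply: le_measure; rewrite ?inE; [exact: mT|exact: (mT _ (measurable_open_Delta oU))|].
  exact: preimage_subset.
rewrite -[X in (_ <= b X)%E](preimage_shiftK y).
exact/open_le_preimage_shift/open_preimage_shift.
Qed.

(** [preimage_shift_le] at [- y] gives one inequality; at [y], applied to the image, it gives the
    other. *)
Lemma measure_image_shift (y : E) (F : set (BDelta A)) : measurable F ->
  b (T y @` F) = b F.
Proof.
move=> mF; rewrite image_shift_Delta; apply/eqP; rewrite eq_le preimage_shift_le//=.
rewrite -{1}(preimage_shiftK (- y) F) opprK; apply: preimage_shift_le.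
by rewrite -[X in measurable X]setTI; exact: measurable_shift_Delta.
Qed.

End invariance.

Theorem theorem2p2 (R : realType) (N : nat) (A : Hsupralgebra R N)
  (A_transl : forall (u : 'rV[R]_N -> CC R) (y : 'rV[R]_N),
      A u -> A (fun x => u (x + y)))
  (A_uc : forall u : 'rV[R]_N -> CC R, A u -> unif_continuous u) :
  exists T : 'rV[R]_N -> Delta A -> Delta A,
    (forall y, homeo (T y)) /\
    (forall y u (s : Delta A), A u ->
        gelfand A (fun x => u (x + y)) s = gelfand A u (T y s)) /\
    (forall T' : 'rV[R]_N -> Delta A -> Delta A,
        (forall y u (s : Delta A), A u ->
           gelfand A (fun x => u (x + y)) s = gelfand A u (T' y s)) ->
        T' = T) /\
    dynamical_system T /\
    (forall b : probability (BDelta A) R, M_measure b ->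
       forall (y : 'rV[R]_N) (F : set (BDelta A)), measurable F ->
         b (T y @` F) = b F).
Proof.
exists (shift_Delta A_transl); split; first exact: shift_Delta_homeo.
split; first by move=> y u s; exact: gelfand_shift.
split; first exact: shift_Delta_unique.
split; first exact: shift_Delta_dynamical.
move=> b Mb y F mF; case: N => [|n] in A A_transl A_uc b Mb y F mF *.
  (* [lebN] is identically [+oo] when [N = 0], but then [y = 0] *)
  by rewrite [y]thinmx0 shift_Delta0 image_id.
exact: measure_image_shift.
Qed.
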